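(* Consider the Cauchy problem for the rotating shallow water system on $\mathbb{R}^2$, $$\begin{cases}\partial_t h+\partial_x(hu)+\partial_y(hv)=0,\\ \partial_t u+u\,\partial_x u+v\,\partial_y u-v=-\partial_x h,\\ \partial_t v+u\,\partial_x v+v\,\partial_y v+u=-\partial_y h,\end{cases}$$ with initial data $(h,u,v)|_{t=0}=(h_0,u_0,v_0)$, where $h_0\ge 0$. Suppose there exist a constant $\bar h\ge 0$ and $R>0$ such that $h_0-\bar h$, $u_0$ and $v_0$ are supported in $B_R=\{(x,y): x^2+y^2\le R^2\}$. Define $$P_1(0)=\int_{\mathbb{R}^2}(h_0u_0x+h_0v_0y)\,dxdy,\qquad P_2(0)=\int_{\mathbb{R}^2}(h_0v_0x-h_0u_0y)\,dxdy,$$ $$E(0)=\int_{\mathbb{R}^2}\bigl(h_0(u_0^2+v_0^2)+h_0^2-\bar h^2\bigr)\,dxdy,\qquad m(0)=\int_{\mathbb{R}^2}(h_0-\bar h)\,dxdy.$$ If $m(0)>0$ and $$P_1(0)^2+(E(0)+P_2(0))^2\ \ge\ \pi\,(R+2\pi\sqrt{\bar h})^4\,E(0)\,\|h_0\|_{L^\infty},$$ then the classical solution of the Cauchy problem loses $C^1$ regularity before time $2\pi$; that is, there is no classical ($C^1$) solution on $\mathbb{R}^2\times[0,2\pi)$ with these initial data.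
   Context: $h$ denotes the height of the fluid (a nonnegative quantity), and $u,v$ are the velocity components in the $x$ and $y$ directions. A classical solution on $\mathbb{R}^2\times[0,T)$ is a triple $(h,u,v)$ of $C^1$ functions satisfying the equations pointwise and attaining the initial data at $t=0$. *)

(* Defs.v *)
From HB Require Import structures.
From mathcomp Require Import all_boot all_order all_algebra.
From mathcomp Require Import all_classical all_reals all_analysis.

Set Implicit Arguments.
Unset Strict Implicit.
Unset Printing Implicit Defensive.

Import Order.TTheory GRing.Theory Num.Theory.
Import numFieldNormedType.Exports.

Local Open Scope classical_set_scope.
Local Open Scope ring_scope.

(* Points of the plane are pairs (x, y) : R * R and points of space-time are
   pairs ((x, y), t) : (R * R) * R. *)

Definition slab (R : realType) (T : R) : set (R * R * R) :=
  [set p | 0 <= p.2 < T].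

Definition e_x (R : realType) : R * R * R := (1, 0, 0).
Definition e_y (R : realType) : R * R * R := (0, 1, 0).

Definition dx (R : realType) (f : R * R * R -> R) (p : R * R * R) : R :=
  'D_(e_x R) f p.

Definition dy (R : realType) (f : R * R * R -> R) (p : R * R * R) : R :=
  'D_(e_y R) f p.

(* The time increment s is restricted to t + s >= 0, so that the time
   derivative is two-sided for t > 0 and one-sided (from the right) at the
   initial time t = 0, before which solutions are not defined. *)
Definition dt_filter (R : realType) (t : R) : set_system R :=
  within [set s | 0 <= t + s] 0^'.

Definition dt_quotient (R : realType) (f : R * R * R -> R) (p : R * R * R)
    (s : R) : R :=
  s^-1 * (f (p.1, p.2 + s) - f p).

Definition dt_derivable (R : realType) (f : R * R * R -> R)
    (p : R * R * R) : Prop :=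
  cvg (dt_quotient f p @ dt_filter p.2).

Definition dt (R : realType) (f : R * R * R -> R) (p : R * R * R) : R :=
  lim (dt_quotient f p @ dt_filter p.2).

(* f is of class C^1 on R^2 x [0, T): it is continuous and its first-order
   partial derivatives exist and are continuous there, with continuity
   relative to R^2 x [0, T). *)
Definition C1_slab (R : realType) (T : R) (f : R * R * R -> R) : Prop :=
  [/\ {within slab T, continuous f},
      forall p, slab T p ->
        [/\ derivable f p (e_x R), derivable f p (e_y R) & dt_derivable f p] &
      [/\ {within slab T, continuous (dx f)},
          {within slab T, continuous (dy f)} &
          {within slab T, continuous (dt f)}]].

Definition rotating_shallow_water (R : realType) (T : R)
    (h u v : R * R * R -> R) : Prop :=
  forall p, slab T p ->
    [/\ dt h p + dx (fun q => h q * u q) p + dy (fun q => h q * v q) p = 0,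
        dt u p + u p * dx u p + v p * dy u p - v p = - dx h p &
        dt v p + u p * dx v p + v p * dy v p + u p = - dy h p].

Definition classical_solution (R : realType) (T : R) (h0 u0 v0 : R * R -> R)
    (h u v : R * R * R -> R) : Prop :=
  [/\ [/\ C1_slab T h, C1_slab T u & C1_slab T v],
      rotating_shallow_water T h u v &
      forall z : R * R,
        [/\ h (z, 0) = h0 z, u (z, 0) = u0 z & v (z, 0) = v0 z]].

(* The Euclidean disc; the library's ball on R * R is that of the max norm. *)
Definition disc (R : realType) (r : R) : set (R * R) :=
  [set z | z.1 ^+ 2 + z.2 ^+ 2 <= r ^+ 2].

Definition supported_in (R : realType) (f : R * R -> R) (A : set (R * R)) :
    Prop :=
  closure [set z | f z != 0] `<=` A.

Definition lebesgue2 (R : realType) :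
    {measure set (measurableTypeR R * measurableTypeR R) -> \bar R} :=
  (@lebesgue_measure R \x @lebesgue_measure R)%E.

Definition P1 (R : realType) (h0 u0 v0 : R * R -> R) : R :=
  \int[lebesgue2 R]_z (h0 z * u0 z * z.1 + h0 z * v0 z * z.2).

Definition P2 (R : realType) (h0 u0 v0 : R * R -> R) : R :=
  \int[lebesgue2 R]_z (h0 z * v0 z * z.1 - h0 z * u0 z * z.2).

Definition energy (R : realType) (hbar : R) (h0 u0 v0 : R * R -> R) : R :=
  \int[lebesgue2 R]_z
    (h0 z * (u0 z ^+ 2 + v0 z ^+ 2) + h0 z ^+ 2 - hbar ^+ 2).

Definition mass (R : realType) (hbar : R) (h0 : R * R -> R) : R :=
  \int[lebesgue2 R]_z (h0 z - hbar).

Definition Linfty_norm (R : realType) (f : R * R -> R) : \bar R :=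
  ('N[lebesgue2 R]_+oo [EFin \o f])%E.

(* Main.v *)
Require Import Defs.
From HB Require Import structures.
From mathcomp Require Import all_boot all_order all_algebra.
From mathcomp Require Import all_classical all_reals all_analysis.
From mathcomp Require Import measurable_realfun ess_sup_inf.
From mathcomp Require Import ring lra.
Import Order.TTheory GRing.Theory Num.Theory.
Import numFieldNormedType.Exports.
Local Open Scope classical_set_scope.
Local Open Scope ring_scope.

Set Implicit Arguments.
Unset Strict Implicit.
Unset Printing Implicit Defensive.

(* The perturbation of the rest state (hbar, 0, 0) spreads at most at the sound
   speed sqrt hbar, as the relative energy in shrinking cones shows. Hence the
   mass, the energy E and the two momenta P1 (radial) and P2 (angular) are
   finite; mass and energy are conserved, and P1' = E + P2, P2' = - P1. So
   (P1, E + P2) rotates with period 2 pi, and at some time t in [0, pi] one has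
   E + P2 = 0 and P1 (t) ^ 2 = P1 (0) ^ 2 + (E + P2 (0)) ^ 2. But the
   Cauchy-Schwarz inequality bounds P1 (t) ^ 2 by the kinetic energy times the
   moment of inertia; the former is strictly below E because the mass is
   positive, and the latter is at most pi rho ^ 4 ||h0|| with
   rho = r + 2 pi sqrt hbar, which contradicts the assumption on the data. *)

(** * Integration over the plane of continuous functions with bounded support *)

(** Nothing bounds the maximum of the height at later times by [||h0||], so the moment of inertia is
    reached through the mass. At time 0 the mass is at most [||h0|| - hbar] times the area of the
    disc; the mass is conserved; hence at time t the fluid in the disc of radius [rho], mass plus
    [hbar] times area, is at most [||h0||] times [pi rho ^ 2]. Weighting by the squared distance to
    the origin gives the other factor [rho ^ 2]. Two obstacles shape the propagation argument.
    Signals move at the fluid speed plus the sound speed, so the cones need a speed slightly above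
    [sqrt hbar], and the velocity bound that justifies it is known only where rest is already
    established: a bootstrap over short time steps breaks the circle. When [hbar = 0], the energy no
    longer sees the velocity, and a second energy takes over. No boundary integral appears: cones
    are encoded by C^1 cutoffs, all integrals run over the plane, and divergences integrate to zero
    by Fubini. *)

Lemma open_measurable2 (R : realType) (U : set (R * R)) :
  open U -> measurable (U : set (measurableTypeR R * measurableTypeR R)).
Proof.
move=> oU.
pose F (q : rat * rat * rat) : set (R * R) :=
  ball (ratr q.1.1 : R) (ratr q.2 : R) `*` ball (ratr q.1.2 : R) (ratr q.2).
(* Squares with rational centre and radius form a countable base of the topology. *)
have -> : U = \bigcup_(q in [set q | F q `<=` U]) F q.
  apply/seteqP; split=> [z Uz|z [q /=]]; last by apply.
  have /nbhs_ballP[e /= e0 eU] : nbhs z U by exact: open_nbhs_nbhs.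
  have [d] := @rat_in_itvoo R 0 (e / 2) (divr_gt0 e0 (@ltr0n _ 2)).
  rewrite in_itv/= => /andP[d0 de].
  have near_rat (x : R) : exists q : rat, `|ratr q - x| < ratr d.
    have [q] := @rat_in_itvoo R (x - ratr d) (x + ratr d) ltac:(lra).
    rewrite in_itv/= => /andP[q1 q2]; exists q.
    by rewrite ltr_norml; apply/andP; split; lra.
  have [a Ha] := near_rat z.1; have [b Hb] := near_rat z.2.
  exists (a, b, d); last by split; rewrite /= /ball/=.
  move=> w [/= wa wb]; apply: eU; split.
  - apply: (@ball_splitr _ _ (ratr a : R)); rewrite /ball/=.
    + exact: lt_trans Ha de.
    + exact: lt_trans wa de.
  - apply: (@ball_splitr _ _ (ratr b : R)); rewrite /ball/=.
    + exact: lt_trans Hb de.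
    + exact: lt_trans wb de.
rewrite bigcup_mkcond; apply: countable_bigcupT_measurable => // q.
case: ifPn => // _.
by apply: measurableX; exact: measurable_ball.
Qed.

Lemma continuous_measurable2 (R : realType) (f : R * R -> R) : continuous f ->
  measurable_fun [set: measurableTypeR R * measurableTypeR R] f.
Proof.
move=> /continuousP cf; apply: (measurability _ (RGenOpens.measurableE R)).
move=> _ [_ [a [b ->] <-]]; rewrite setTI.
by apply: open_measurable2; apply: cf; exact: interval_open.
Qed.

(** Squares carry the supports because a product of two segments is compact and suits Fubini; discs
    come in only where the radius enters an estimate. *)
Definition box (R : realType) (M : R) : set (R * R) := `[- M, M] `*` `[- M, M].

Definition supp_box (R : realType) (M : R) (f : R * R -> R) : Prop :=
  forall z, ~ box M z -> f z = 0.

Lemma measurable_box (R : realType) (M : R) :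
  measurable (box M : set (measurableTypeR R * measurableTypeR R)).
Proof. by apply: measurableX; exact: measurable_itv. Qed.

Lemma compact_box (R : realType) (M : R) : compact (box M).
Proof. by apply: compact_setX; exact: segment_compact. Qed.

Lemma lebesgue2_box_lty (R : realType) (M : R) :
  (lebesgue2 R (box M) < +oo)%E.
Proof.
have -> : lebesgue2 R (box M) =
    (lebesgue_measure [set` `[(- M)%R, M]%R] *
     lebesgue_measure [set` `[(- M)%R, M]%R])%E.
  by apply: product_measure1E; exact: measurable_itv.
rewrite /= lebesgue_measure_itv/= !lte_fin.
by case: ifPn => _; rewrite ?mule0 ?mul0e -?EFinD -?EFinM ltry.
Qed.

Lemma integrable_cst_indic d (R : realType) (T : measurableType d)
    (mu : {measure set T -> \bar R}) (A : set T) (C : R) :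
  measurable A -> (mu A < +oo)%E ->
  mu.-integrable setT (EFin \o (fun z => C * \1_A z)).
Proof.
move=> mA Aoo; rewrite (_ : _ \o _ = (fun z => C%:E * (\1_A z)%:E)%E); last first.
  by apply/funext => z; rewrite /= EFinM.
apply: integrableZl => //; apply/integrableP; split; first exact/measurable_EFinP.
under eq_integral do rewrite gee0_abs ?lee_fin//.
by rewrite integral_indic// setIT.
Qed.

Lemma integrable_cst_box (R : realType) (M C : R) :
  (lebesgue2 R).-integrable setT (EFin \o (fun z => C * \1_(box M) z)).
Proof.
by apply: integrable_cst_indic; [exact: measurable_box|exact: lebesgue2_box_lty].
Qed.

Lemma bounded_on_compact (R : realType) (T : topologicalType) (A : set T)
    (f : T -> R) : compact A -> continuous f ->
  exists C, 0 <= C /\ forall x, A x -> `|f x| <= C.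
Proof.
move=> cA cf.
have /compact_bounded [B [_ HB]] : compact (f @` A).
  by apply: continuous_compact => //; exact: continuous_subspaceT.
exists (`|B| + 1); split; first by rewrite addr_ge0.
move=> x Ax; apply: (HB (`|B| + 1)); last by exists x.
by rewrite (le_lt_trans (ler_norm B))// ltrDl.
Qed.

Lemma supp_box_le (R : realType) (M : R) (f : R * R -> R) C :
  0 <= C -> supp_box M f -> (forall z, box M z -> `|f z| <= C) ->
  forall z, `|f z| <= C * \1_(box M) z.
Proof.
move=> C0 sf bf z; rewrite indicE; have [/set_mem zb|/negP zb] := boolP (z \in box M).
  by rewrite mulr1 bf.
by rewrite sf ?normr0 ?mulr0// => ?; apply: zb; rewrite inE.
Qed.

Lemma integrable_supp_box (R : realType) (M : R) (f : R * R -> R) :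
  continuous f -> supp_box M f -> (lebesgue2 R).-integrable setT (EFin \o f).
Proof.
move=> cf sf; have [C [C0 HC]] := bounded_on_compact (@compact_box R M) cf.
apply: le_integrable (integrable_cst_box M C) => //.
  by apply/measurable_EFinP; exact: continuous_measurable2.
move=> z _ /=; rewrite lee_fin (le_trans (supp_box_le C0 sf HC z))//.
exact: ler_norm.
Qed.

Lemma continuous_add (R : realType) (T : topologicalType) (f g : T -> R) :
  continuous f -> continuous g -> continuous (fun x => f x + g x).
Proof. by move=> cf cg x; apply: cvgD; [exact: cf|exact: cg]. Qed.

Lemma continuous_mul (R : realType) (T : topologicalType) (f g : T -> R) :
  continuous f -> continuous g -> continuous (fun x => f x * g x).
Proof. by move=> cf cg x; apply: cvgM; [exact: cf|exact: cg]. Qed.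

Lemma continuous_opp (R : realType) (T : topologicalType) (f : T -> R) :
  continuous f -> continuous (fun x => - f x).
Proof. by move=> cf x; apply: cvgN; exact: cf. Qed.

Lemma continuous_sub (R : realType) (T : topologicalType) (f g : T -> R) :
  continuous f -> continuous g -> continuous (fun x => f x - g x).
Proof. by move=> cf cg x; apply: cvgB; [exact: cf|exact: cg]. Qed.

Lemma continuous_sqr (R : realType) (T : topologicalType) (f : T -> R) :
  continuous f -> continuous (fun x => f x ^+ 2).
Proof. by move=> cf; exact: continuous_mul. Qed.

Lemma continuous_composite (T1 T2 T3 : topologicalType) (f : T1 -> T2) (g : T2 -> T3) :
  continuous f -> continuous g -> continuous (fun x => g (f x)).
Proof. by move=> cf cg x; apply: continuous_comp; [exact: cf|exact: cg]. Qed.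

Lemma continuous_const (T1 T2 : topologicalType) (c : T2) :
  continuous (fun _ : T1 => c).
Proof. by move=> x; exact: cvg_cst. Qed.

Lemma continuous_pair1 (T1 T2 T3 : topologicalType) (f : T1 * T2 -> T3) (y : T2) :
  continuous f -> continuous (fun x => f (x, y)).
Proof.
move=> cf x; apply: (@continuous_comp _ _ _ (fun x => (x, y)) f); last exact: cf.
by apply: cvg_pair => /=; [exact: cvg_id|exact: cvg_cst].
Qed.

Lemma continuous_pair2 (T1 T2 T3 : topologicalType) (f : T1 * T2 -> T3) (x : T1) :
  continuous f -> continuous (fun y => f (x, y)).
Proof.
move=> cf y; apply: (@continuous_comp _ _ _ (fun y => (x, y)) f); last exact: cf.
by apply: cvg_pair => /=; [exact: cvg_cst|exact: cvg_id].
Qed.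

Lemma notin_boxl (R : realType) (M x y : R) : M < `|x| -> ~ box M (x, y).
Proof.
move=> Mx []/= + _; rewrite in_itv/= => xM.
by move: Mx; rewrite ltNge ler_norml xM.
Qed.

Lemma notin_boxr (R : realType) (M x y : R) : M < `|y| -> ~ box M (x, y).
Proof.
move=> Mx []/= _; rewrite in_itv/= => xM.
by move: Mx; rewrite ltNge ler_norml xM.
Qed.

Lemma integral_derive_compact_supp (R : realType) (M : R) (f g : R -> R) :
  continuous g -> (forall x : R, is_derive x 1 f (g x)) ->
  (forall x, M < `|x| -> f x = 0) -> (forall x, M < `|x| -> g x = 0) ->
  (\int[@lebesgue_measure R]_x (g x)%:E = 0)%E.
Proof.
(* [M] may be negative; [K] is positive and beyond [M], so [f] vanishes at both endpoints. *)
move=> cg df f0 g0; pose K : R := `|M| + 1.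
have MK : M < K by rewrite (le_lt_trans (ler_norm M))// ltrDl.
have K0 : 0 < K by rewrite ltr_wpDl.
transitivity (\int[@lebesgue_measure R]_(x in [set` `[- K, K]%R]) (g x)%:E)%E.
  rewrite [RHS]integral_mkcond; apply: eq_integral => x _.
  rewrite patchE; case: ifPn => //; rewrite notin_setE/= in_itv/= => /negP.
  by rewrite -ler_norml -ltNge => Kx; rewrite g0// (lt_trans MK).
have cf : continuous f.
  by move=> x; apply/differentiable_continuous/derivable1_diffP.
rewrite (@continuous_FTC2 _ g f).
- by rewrite !f0 ?subee// ?normrN gtr0_norm.
- by rewrite gtrN.
- exact: continuous_subspaceT.
- split; [by []| |]; first exact: cvg_at_right_filter (cf _).
  exact: cvg_at_left_filter (cf _).
- by move=> x _; rewrite derive1E derive_val.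
Qed.

(** Half of the divergence theorem: with x as the inner variable, the primitive [f] vanishes at both
    ends of each horizontal line. *)
Lemma Rintegral_dx_eq0 (R : realType) (M : R) (f g : R * R -> R) :
  continuous g -> (forall x y : R, is_derive x 1 (fun s => f (s, y)) (g (x, y))) ->
  supp_box M f -> supp_box M g -> \int[lebesgue2 R]_z g z = 0.
Proof.
move=> cg df sf sg; rewrite /Rintegral.
have /integral21_prod_meas1 <- := integrable_supp_box cg sg.
rewrite integral0_eq//= => y _; rewrite /fubini_G/=.
apply: (@integral_derive_compact_supp _ M (fun x => f (x, y))) => //.
- exact: continuous_pair1.
- by move=> x Mx; apply: sf; exact: notin_boxl.
- by move=> x Mx; apply: sg; exact: notin_boxl.
Qed.

Lemma Rintegral_dy_eq0 (R : realType) (M : R) (f g : R * R -> R) :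
  continuous g -> (forall x y : R, is_derive y 1 (fun s => f (x, s)) (g (x, y))) ->
  supp_box M f -> supp_box M g -> \int[lebesgue2 R]_z g z = 0.
Proof.
move=> cg df sf sg; rewrite /Rintegral.
have /integral12_prod_meas1 <- := integrable_supp_box cg sg.
rewrite integral0_eq//= => x _; rewrite /fubini_F/=.
apply: (@integral_derive_compact_supp _ M (fun y => f (x, y))) => //.
- exact: continuous_pair2.
- by move=> y My; apply: sf; exact: notin_boxr.
- by move=> y My; apply: sg; exact: notin_boxr.
Qed.

(** * Integrals over the plane depending on time *)

Definition clamp (R : realType) (a b t : R) : R := Num.max a (Num.min b t).

Lemma clamp_id (R : realType) (a b t : R) : a <= t <= b -> clamp a b t = t.
Proof. by move=> /andP[at_ tb]; rewrite /clamp min_r// max_r. Qed.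

Lemma clamp_itv (R : realType) (a b t : R) : a <= b -> a <= clamp a b t <= b.
Proof. by move=> ab; rewrite /clamp le_max lexx/= ge_max ab ge_min lexx. Qed.

Lemma continuous_clamp (R : realType) (a b : R) : continuous (clamp a b).
Proof.
move=> t; apply: continuous_max; first exact: cvg_cst.
by apply: continuous_min; [exact: cvg_cst|exact: cvg_id].
Qed.

Lemma continuous_clamp2 (R : realType) (T : topologicalType) (a b : R) :
  continuous (fun p : T * R => (p.1, clamp a b p.2)).
Proof.
have c2 : continuous (fun p : T * R => clamp a b p.2).
  by apply: continuous_composite (@continuous_clamp _ a b) => p; exact: cvg_snd.
move=> p; apply: (@cvg_pair _ _ _ (nbhs p) (nbhs p.1) (nbhs (clamp a b p.2))
  _ _ _ fst (fun p => clamp a b p.2)); [exact: cvg_fst|exact: c2].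
Qed.

Lemma bounded_supp_box (R : realType) (M a b : R) (F : R * R * R -> R) :
  continuous F ->
  exists C, 0 <= C /\ forall t, a <= t <= b -> supp_box M (fun z => F (z, t)) ->
    forall z, `|F (z, t)| <= C * \1_(box M) z.
Proof.
move=> cF.
have cK : compact (box M `*` [set` `[a, b]]).
  by apply: compact_setX; [exact: compact_box|exact: segment_compact].
have [C [C0 HC]] := bounded_on_compact cK cF.
exists C; split=> // t tab sF z; apply: (supp_box_le C0 sF) => w Mw.
by apply: HC; split=> //=; rewrite in_itv.
Qed.

Lemma continuous_Rintegral_supp (R : realType) (M a b : R) (F : R * R * R -> R) :
  a <= b -> continuous F ->
  (forall t, a <= t <= b -> supp_box M (fun z => F (z, t))) ->
  {within [set` `[a, b]], continuous (fun t => \int[lebesgue2 R]_z F (z, t))}.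
Proof.
move=> ab cF sF.
(* Continuity under the integral is applied on an open interval around [t], while the support is
   controlled on [a, b] only; after clamping it is controlled at all times. *)
pose G (p : R * R * R) := F (p.1, clamp a b p.2).
have cG : continuous G.
  by apply: continuous_composite cF; exact: continuous_clamp2.
have sG t : supp_box M (fun z => G (z, t)).
  by move=> z; apply: (sF (clamp a b t)); exact: clamp_itv.
suff cI : continuous (fun t => \int[lebesgue2 R]_z G (z, t)).
  apply: (@subspace_eq_continuous _ _ _ (fun t => \int[lebesgue2 R]_z G (z, t))).
    move=> t; rewrite inE/= in_itv/= => tab; apply: eq_Rintegral => z _.
    by rewrite /G/= clamp_id.
  exact: continuous_subspaceT.
move=> t.
have [C [C0 HC]] := bounded_supp_box M (t - 1) (t + 1) cG.
apply: (@continuity_under_integral _ _ _ (lebesgue2 R) (fun t z => G (z, t)) setT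
  measurableT (t - 1) (t + 1) _ _ _ (integrable_cst_box M C)).
- move=> s _; apply: integrable_supp_box (sG s).
  exact: continuous_pair1.
- by apply: aeW => z _ s _; exact: continuous_pair2.
- move=> s /=; rewrite in_itv/= => /andP[s1 s2]; apply: aeW => z _.
  by apply: HC; rewrite ?ltW//; exact: sG.
- by rewrite inE/= in_itv/= ltrDl ltrBlDr ltrDl ltr01.
Qed.

Lemma is_derive_Rintegral_supp (R : realType) (M a b : R) (F Ft : R * R * R -> R) :
  continuous F -> continuous Ft ->
  (forall t, a < t < b -> supp_box M (fun z => F (z, t))) ->
  (forall t, a < t < b -> supp_box M (fun z => Ft (z, t))) ->
  (forall z t, a < t < b -> is_derive t 1 (fun s => F (z, s)) (Ft (z, t))) ->
  forall t : R, a < t < b ->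
  is_derive t 1 (fun s => \int[lebesgue2 R]_z F (z, s))
    (\int[lebesgue2 R]_z Ft (z, t)).
Proof.
move=> cF cFt sF sFt dF t tab.
have [C [C0 HC]] := bounded_supp_box M a b cFt.
have part s z : a < s < b -> partial1of2 (fun t z => F (z, t)) s z = Ft (z, s).
  by move=> sab; rewrite partial1of2E; have := dF z s sab => ?; rewrite derive_val.
have Hlim : h^-1 *: (\int[lebesgue2 R]_z F (z, h + t) - \int[lebesgue2 R]_z F (z, t))
     @[h --> 0^'] --> \int[lebesgue2 R]_z Ft (z, t).
  rewrite -(@eq_Rintegral _ _ _ (lebesgue2 R) setT (fun z => Ft (z, t))
     (partial1of2 (fun t z => F (z, t)) t)); last by move=> z _; rewrite part.
  apply: (@cvg_differentiation_under_integral _ _ _ (lebesgue2 R)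
    (fun t z => F (z, t)) setT measurableT t a b _ _ _
    (fun z => C * \1_(box M) z) _ (integrable_cst_box M C)).
  - by rewrite /= in_itv.
  - move=> s /=; rewrite in_itv/= => sab; apply: integrable_supp_box (sF s sab).
    exact: continuous_pair1.
  - by move=> s z /=; rewrite in_itv/= => sab _; have [] := dF z s sab.
  - by move=> z; rewrite mulr_ge0.
  - move=> s z /=; rewrite in_itv/= => sab _; rewrite part//.
    by apply: HC; [case/andP: sab => ? ?; rewrite !ltW|exact: sFt].
split.
  apply/cvg_ex; eexists; under eq_fun do rewrite scaler1; exact: Hlim.
by apply/cvg_lim => //; under eq_fun do rewrite scaler1.
Qed.

(** A nonempty open set contains a square of positive measure, so it is not null. This turns almost
    everywhere statements about continuous functions into pointwise ones. *)
Lemma ae_open_exists (R : realType) (P : R * R -> Prop) (U : set (R * R)) z :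
  open U -> U z -> (\forall z \ae lebesgue2 R, P z) -> exists2 w, U w & P w.
Proof.
move=> oU Uz [N [mN N0 PN]]; apply: contrapT => nP.
have UN : U `<=` N.
  by move=> w Uw; apply: PN => /= Pw; apply: nP; exists w.
have /nbhs_ballP[e /= e0 eU] : nbhs z U by exact: open_nbhs_nbhs.
pose B : set (R * R) := ball z.1 e `*` ball z.2 e.
have mB : measurable (B : set (measurableTypeR R * measurableTypeR R)).
  by apply: measurableX; exact: measurable_ball.
have : (lebesgue2 R B <= lebesgue2 R N)%E.
  by apply: le_measure; rewrite ?inE// => w [? ?]; exact/UN/eU.
have -> : lebesgue2 R B = (lebesgue_measure (ball z.1 e : set R) *
    lebesgue_measure (ball z.2 e : set R))%E.
  by apply: product_measure1E; exact: measurable_ball.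
have mu_ball (x : R) : lebesgue_measure (ball x e : set R) = (e *+ 2)%:E.
  by rewrite lebesgue_measure_ball ?ltW.
rewrite N0 !mu_ball -EFinM lee_fin leNgt.
by rewrite mulr_gt0// mulrn_wgt0.
Qed.

Lemma Rintegral_eq0_supp (R : realType) (M : R) (f : R * R -> R) :
  continuous f -> supp_box M f -> (forall z, 0 <= f z) ->
  \int[lebesgue2 R]_z f z = 0 -> forall z, f z = 0.
Proof.
move=> cf sf f0 intf z; apply/eqP; rewrite eq_le f0 andbT leNgt.
apply/negP => fz; have intgf := integrable_supp_box cf sf.
have I0 : (\int[lebesgue2 R]_z `|(EFin \o f) z| = 0)%E.
  under eq_integral do rewrite gee0_abs ?lee_fin//.
  by rewrite -[LHS]fineK ?integrable_fin_num//= -/(Rintegral _ _ _) intf.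
have /ae_eq_integral_abs : measurable_fun setT
    (EFin \o f : measurableTypeR R * measurableTypeR R -> \bar R).
  by apply/measurable_EFinP; exact: continuous_measurable2.
move=> /(_ (lebesgue2 R) measurableT)[/(_ I0) ae0 _].
have oU : open [set w | 0 < f w].
  move/continuousP: cf => /(_ _ (@interval_open _ (BRight 0) +oo%O isT isT)).
  rewrite (_ : f @^-1` _ = [set w | 0 < f w])//.
  by apply/seteqP; split=> w /=; rewrite in_itv/= andbT.
have [w /= fw] := ae_open_exists oU fz ae0.
by move=> /(_ I)[fw0]; rewrite fw0 ltxx in fw.
Qed.

(** * The area of a disc *)

Lemma measurable_disc (R : realType) (r : R) :
  measurable (disc r : set (measurableTypeR R * measurableTypeR R)).
Proof.
rewrite (_ : disc r = ~` [set z | r ^+ 2 < z.1 ^+ 2 + z.2 ^+ 2]); last first.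
  by apply/seteqP; split=> z /=; rewrite /disc/= leNgt => /negP.
apply: measurableC; apply: open_measurable2.
have cg : continuous (fun z : R * R => z.1 ^+ 2 + z.2 ^+ 2).
  by apply: continuous_add; apply: continuous_sqr => z; [exact: cvg_fst|exact: cvg_snd].
move/continuousP: cg => /(_ _ (@interval_open _ (BRight (r ^+ 2)) +oo%O isT isT)).
rewrite (_ : _ @^-1` _ = [set z | r ^+ 2 < z.1 ^+ 2 + z.2 ^+ 2])//.
by apply/seteqP; split=> w /=; rewrite in_itv/= andbT.
Qed.

(** The substitution [x = r * sin t] on [- pi / 2, pi / 2] gives the integrand
    [2 * r ^+ 2 * cos t ^+ 2], whose primitive is [r ^+ 2 * (t + sin t * cos t)]. *)
Lemma integral_sqrt_circle (R : realType) (r : R) : 0 < r ->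
  (\int[@lebesgue_measure R]_(x in [set` `[- r, r]%R])
    (2 * Num.sqrt (r ^+ 2 - x ^+ 2))%:E = (pi * r ^+ 2)%:E)%E.
Proof.
move=> r0; pose a : R := pi / 2; have a0 : 0 < a by rewrite divr_gt0 ?pi_gt0.
pose F (t : R) := r * sin t.
have dF (t : R) : is_derive t 1 F (r * cos t).
  by apply: is_derive_eq; rewrite /GRing.scale/=; ring.
have F'E : (derive1 F) = (fun t => r * cos t).
  by apply/funext => t; rewrite derive1E derive_val.
have cF' : continuous (derive1 F).
  by move=> t; rewrite F'E; apply: cvgM; [exact: cvg_cst|exact: continuous_cos].
have cF : continuous F.
  by move=> t; apply: cvgM; [exact: cvg_cst|exact: continuous_sin].
have FaE : F a = r by rewrite /F sin_pihalf mulr1.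
have FNaE : F (- a) = - r by rewrite /F sinN sin_pihalf mulrN1.
have -> : [set` `[- r, r]%R] = [set` `[F (- a), F a]%R] by rewrite FNaE FaE.
rewrite (@integration_by_substitution_increasing _ F
  (fun x => 2 * Num.sqrt (r ^+ 2 - x ^+ 2)) (- a) a).
- transitivity (\int[@lebesgue_measure R]_(t in [set` `[- a, a]%R])
     (2 * r ^+ 2 * cos t ^+ 2)%:E)%E.
    apply: eq_integral => t; rewrite inE/= in_itv/= => ta.
    have ct : 0 <= cos t by exact: cos_ge0_pihalf.
    have E : r ^+ 2 - F t ^+ 2 = (r * cos t) ^+ 2.
      by rewrite /F !exprMn sin2cos2; ring.
    rewrite /= !fctE/= E sqrtr_sqr ger0_norm ?mulr_ge0 ?(ltW r0)// F'E; congr EFin => /=.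
    by ring.
  pose H (t : R) := r ^+ 2 * (t + sin t * cos t).
  have dH (t : R) : is_derive t 1 H (2 * r ^+ 2 * cos t ^+ 2).
    apply: is_derive_eq; rewrite /GRing.scale/=.
    have := cos2Dsin2 t => h.
    have -> : sin t * - sin t = cos t ^+ 2 - 1 by rewrite -h; ring.
    by ring.
  have cH : continuous H.
    by move=> t; apply/differentiable_continuous/derivable1_diffP.
  rewrite (@continuous_FTC2 _ _ H).
  + rewrite /H cosN sinN cos_pihalf !mulr0 !addr0 -EFinB /a; congr EFin; by field.
  + by rewrite gtrN.
  + apply: continuous_subspaceT; apply: continuous_mul; first exact: continuous_const.
    by apply: continuous_sqr; exact: continuous_cos.
  + split; [by []| |]; first exact: cvg_at_right_filter (cH _).
    exact: cvg_at_left_filter (cH _).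
  + by move=> x _; rewrite derive1E derive_val.
- by rewrite ge0_cp// ltW.
- by move=> x y xa ya xy; rewrite /F ltr_pM2l// ltr_sin.
- by move=> x _; exact: cF'.
- by apply/cvg_ex; eexists; exact: cvg_at_right_filter (cF' _).
- by apply/cvg_ex; eexists; exact: cvg_at_left_filter (cF' _).
- split; [by []| |]; first exact: cvg_at_right_filter (cF _).
  exact: cvg_at_left_filter (cF _).
- apply: continuous_subspaceT.
  apply: continuous_mul; first exact: continuous_const.
  apply: (@continuous_composite R R R (fun x : R => r ^+ 2 - x ^+ 2) Num.sqrt);
    last exact: sqrt_continuous.
  apply: continuous_sub; first exact: continuous_const.
  exact: exprn_continuous.
Qed.

(** The area is the integral of the lengths of the vertical sections. Beyond |x| = r the square root
    of a negative number is 0 by convention, so the integral of the lengths extends to the whole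
    line. *)
Lemma lebesgue2_disc (R : realType) (r : R) : 0 < r ->
  (lebesgue2 R (disc r) <= (pi * r ^+ 2)%:E)%E.
Proof.
move=> r0; rewrite -integral_sqrt_circle//.
have sq (y : R) : r < `|y| -> r ^+ 2 - y ^+ 2 <= 0.
  move=> ry; rewrite subr_le0 -[leRHS]real_normK ?num_real//.
  by apply: lerXn2r; rewrite ?nnegrE// ltW.
pose s (x : R) := 2 * Num.sqrt (r ^+ 2 - x ^+ 2).
have cs : continuous s.
  apply: continuous_mul; first exact: continuous_const.
  apply: (@continuous_composite R R R (fun x : R => r ^+ 2 - x ^+ 2) Num.sqrt);
    last exact: sqrt_continuous.
  apply: continuous_sub; first exact: continuous_const.
  exact: exprn_continuous.
have -> : (\int[@lebesgue_measure R]_(x in [set` `[- r, r]%R]) (s x)%:E =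
   \int[@lebesgue_measure R]_x (s x)%:E)%E.
  rewrite integral_mkcond; apply: eq_integral => x _.
  rewrite patchE; case: ifPn => //; rewrite notin_setE/= in_itv/= => /negP.
  rewrite -ler_norml -ltNge => rx; rewrite /s ler0_sqrtr ?mulr0//.
  exact: sq.
have mA := @measurable_disc R r.
have -> : lebesgue2 R (disc r) = (\int[@lebesgue_measure R]_x
    (lebesgue_measure \o xsection (disc r)) x)%E by [].
apply: ge0_le_integral => //.
- exact: measurable_fun_xsection.
- by apply/measurable_EFinP; exact: continuous_measurable_fun.
- move=> x _ /=; pose q := Num.sqrt (r ^+ 2 - x ^+ 2).
  have q0 : 0 <= q := sqrtr_ge0 _.
  have -> : (s x)%:E = lebesgue_measure [set` `[- q, q]%R].
    rewrite lebesgue_measure_itv/= lte_fin; case: ltP => [qq|qq].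
      by rewrite -EFinB /s -/q; congr EFin; ring.
    by rewrite /s -/q (_ : q = 0) ?mulr0//; lra.
  apply: le_measure; rewrite ?inE//; first exact: measurable_xsection.
  move=> y; rewrite /xsection/= inE/= in_itv/= -ler_norml => xy.
  rewrite -sqrtr_sqr /q ler_wsqrtr// lerBrDr addrC; exact: xy.
Qed.

(** * Functions of class C^1 and balance laws *)

(* All data are continuous on the whole of space-time, but the time derivative
   is only meaningful on ]0, T[: see [clamp_time], which extends a solution by
   freezing it outside [0, T]. *)
Definition C1 (R : realType) (T : R) (f fx fy ft : R * R * R -> R) : Prop :=
  [/\ continuous f, continuous fx, continuous fy, continuous ft &
   [/\ forall x y t : R, is_derive x 1 (fun s => f (s, y, t)) (fx (x, y, t)),
       forall x y t : R, is_derive y 1 (fun s => f (x, s, t)) (fy (x, y, t)) &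
       forall (z : R * R) (t : R), 0 < t < T ->
         is_derive t 1 (fun s => f (z, s)) (ft (z, t))]].

(** Derivatives are explicit data: the closure lemmas compute them along with the function, and each
    balance law then reduces to pointwise algebra. *)
Lemma C1_cst (R : realType) (T c : R) :
  C1 T (fun=> c) (fun=> 0) (fun=> 0) (fun=> 0).
Proof. by split; try exact: continuous_const; split=> *; exact: is_derive_cst. Qed.

Lemma continuous_xcoord (R : realType) : continuous (fun p : R * R * R => p.1.1).
Proof.
by apply: (@continuous_composite _ _ _ (fun p : R * R * R => p.1) fst) => p; exact: cvg_fst.
Qed.

Lemma continuous_ycoord (R : realType) : continuous (fun p : R * R * R => p.1.2).
Proof.
apply: (@continuous_composite _ _ _ (fun p : R * R * R => p.1) snd) => p.
  exact: cvg_fst.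
exact: cvg_snd.
Qed.

Lemma C1_xcoord (R : realType) (T : R) :
  C1 T (fun p => p.1.1) (fun=> 1) (fun=> 0) (fun=> 0).
Proof.
split; try exact: continuous_const; first exact: continuous_xcoord.
by split=> * /=; [exact: is_derive_id|exact: is_derive_cst|exact: is_derive_cst].
Qed.

Lemma C1_ycoord (R : realType) (T : R) :
  C1 T (fun p => p.1.2) (fun=> 0) (fun=> 1) (fun=> 0).
Proof.
split; try exact: continuous_const; first exact: continuous_ycoord.
by split=> * /=; [exact: is_derive_cst|exact: is_derive_id|exact: is_derive_cst].
Qed.

Lemma C1_tcoord (R : realType) (T : R) :
  C1 T (fun p => p.2) (fun=> 0) (fun=> 0) (fun=> 1).
Proof.
split; try exact: continuous_const; first by move=> p; exact: cvg_snd.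
by split=> * /=; [exact: is_derive_cst|exact: is_derive_cst|exact: is_derive_id].
Qed.

Lemma C1_add (R : realType) (T : R) (f fx fy ft g gx gy gt : R * R * R -> R) :
  C1 T f fx fy ft -> C1 T g gx gy gt ->
  C1 T (fun p => f p + g p) (fun p => fx p + gx p) (fun p => fy p + gy p)
    (fun p => ft p + gt p).
Proof.
move=> [cf cfx cfy cft [dfx dfy dft]] [cg cgx cgy cgt [dgx dgy dgt]].
split; try exact: continuous_add.
split=> *; apply: is_deriveD;
  by [exact: dfx|exact: dfy|exact: dft|exact: dgx|exact: dgy|exact: dgt].
Qed.

Lemma C1_opp (R : realType) (T : R) (f fx fy ft : R * R * R -> R) :
  C1 T f fx fy ft ->
  C1 T (fun p => - f p) (fun p => - fx p) (fun p => - fy p) (fun p => - ft p).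
Proof.
move=> [cf cfx cfy cft [dfx dfy dft]]; split; try exact: continuous_opp.
split=> *; apply: is_deriveN; by [exact: dfx|exact: dfy|exact: dft].
Qed.

Lemma C1_sub (R : realType) (T : R) (f fx fy ft g gx gy gt : R * R * R -> R) :
  C1 T f fx fy ft -> C1 T g gx gy gt ->
  C1 T (fun p => f p - g p) (fun p => fx p - gx p) (fun p => fy p - gy p)
    (fun p => ft p - gt p).
Proof. by move=> cf cg; exact: C1_add cf (C1_opp cg). Qed.

Lemma is_derive_mul (R : realType) (f g : R -> R) (x df dg : R) :
  is_derive x 1 f df -> is_derive x 1 g dg ->
  is_derive x 1 (fun s => f s * g s) (df * g x + f x * dg).
Proof.
move=> Hf Hg; apply: is_derive_eq (is_deriveM Hf Hg) _.
by rewrite /GRing.scale/=; ring.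
Qed.

Lemma C1_mul (R : realType) (T : R) (f fx fy ft g gx gy gt : R * R * R -> R) :
  C1 T f fx fy ft -> C1 T g gx gy gt ->
  C1 T (fun p => f p * g p) (fun p => fx p * g p + f p * gx p)
    (fun p => fy p * g p + f p * gy p) (fun p => ft p * g p + f p * gt p).
Proof.
move=> [cf cfx cfy cft [dfx dfy dft]] [cg cgx cgy cgt [dgx dgy dgt]].
split; try exact: continuous_mul;
  try by apply: continuous_add; exact: continuous_mul.
split=> *; apply: is_derive_mul;
  by [exact: dfx|exact: dfy|exact: dft|exact: dgx|exact: dgy|exact: dgt].
Qed.

Lemma is_derive_chain (R : realType) (f g g' : R -> R) (x df : R) :
  (forall y : R, is_derive y 1 g (g' y)) -> is_derive x 1 f df ->
  is_derive x 1 (fun s => g (f s)) (g' (f x) * df).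
Proof.
move=> Hg Hf; have := @is_derive1_comp _ g f x (g' (f x)) df (Hg (f x)) Hf.
by rewrite mulrC.
Qed.

Lemma C1_comp (R : realType) (T : R) (g g' : R -> R) (f fx fy ft : R * R * R -> R) :
  continuous g' -> (forall y : R, is_derive y 1 g (g' y)) ->
  C1 T f fx fy ft ->
  C1 T (fun p => g (f p)) (fun p => g' (f p) * fx p) (fun p => g' (f p) * fy p)
    (fun p => g' (f p) * ft p).
Proof.
move=> cg' dg [cf cfx cfy cft [dfx dfy dft]].
have cg : continuous g.
  by move=> x; apply/differentiable_continuous/derivable1_diffP.
have cg'f : continuous (fun p => g' (f p)) by exact: continuous_composite cf cg'.
split; try exact: continuous_mul; first exact: continuous_composite cf cg.
split=> [x y t|x y t|z t tT].
- by apply: (is_derive_chain (f := fun s => f (s, y, t)) dg); exact: dfx.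
- by apply: (is_derive_chain (f := fun s => f (x, s, t)) dg); exact: dfy.
- by apply: (is_derive_chain (f := fun s => f (z, s)) dg); exact: dft.
Qed.

(** Squaring makes the positive part C^1 across 0. It serves as a cutoff on the cones and, applied
    to [- h], as a measure of negative heights. *)
Definition sqpos (R : realType) (x : R) : R := Num.max 0 x ^+ 2.

Lemma is_derive_sqpos (R : realType) (x : R) :
  is_derive x 1 (@sqpos R) (2 * Num.max 0 x).
Proof.
have [x0|x0|->] := ltgtP x 0.
- rewrite mulr0.
  apply: (@near_eq_is_derive R R R (fun=> 0 : R) (@sqpos R)).
  near=> y; rewrite /sqpos max_l ?expr0n//; apply: ltW.
  by near: y; exact: lt_nbhsl.
- apply: (@near_eq_is_derive R R R (fun y => y * y) (@sqpos R)).
    near=> y; rewrite /sqpos max_r//; apply: ltW.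
    by near: y; exact: lt_nbhsr.
  apply: is_derive_eq (is_derive_mul (is_derive_id _ _) (is_derive_id _ _)) _.
  by ring.
- rewrite mulr0.
  (* The difference quotient at 0 equals [h] or 0, hence is bounded by |h|. *)
  have H : h^-1 *: (sqpos (h *: 1 + 0) - sqpos 0 : R) @[h --> 0^'] --> (0 : R).
    apply/cvgr0Pnorm_le => e e0; near=> h.
    rewrite [h *: 1]mulr1 addr0 /sqpos maxxx expr0n/= subr0 /GRing.scale/=.
    have h0 : h != 0 by near: h; exact: nbhs_dnbhs_neq.
    apply: (@le_trans _ _ `|h|); last first.
      by near: h; exact: dnbhs0_le.
    have [hp|hn] := leP 0 h.
      by rewrite expr2 mulrA mulVf// mul1r.
    by rewrite expr0n/= mulr0 normr0.
  by split; [apply/cvg_ex; exists 0|apply/cvg_lim].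
Unshelve. all: by end_near. Qed.

Lemma continuous_pos (R : realType) : continuous (fun x : R => Num.max 0 x).
Proof. by move=> x; apply: continuous_max; [exact: cvg_cst|exact: cvg_id]. Qed.

Lemma C1_sqpos (R : realType) (T : R) (f fx fy ft : R * R * R -> R) :
  C1 T f fx fy ft ->
  C1 T (fun p => sqpos (f p)) (fun p => 2 * Num.max 0 (f p) * fx p)
    (fun p => 2 * Num.max 0 (f p) * fy p) (fun p => 2 * Num.max 0 (f p) * ft p).
Proof.
apply: (C1_comp (g' := fun x => 2 * Num.max 0 x)); last exact: is_derive_sqpos.
by apply: continuous_mul; [exact: continuous_const|exact: continuous_pos].
Qed.

Lemma is_derive_near0 (R : realType) (f : R -> R) (x d : R) :
  is_derive x 1 f d -> (\forall s \near x, f s = 0) -> d = 0.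
Proof.
move=> df f0; have : is_derive x 1 (fun=> 0 : R) d.
  by apply: near_eq_is_derive df.
by move=> [_ <-]; rewrite derive_cst.
Qed.

Lemma near_normr_gt (R : realType) (M x : R) : M < `|x| ->
  \forall s \near x, M < `|s|.
Proof.
move=> Mx; have cn : continuous (fun s : R => `|s|) by move=> ?; exact: norm_continuous.
exact: (cvgr_gt `|x| (cn x)).
Qed.

Lemma notin_box (R : realType) (M : R) (z : R * R) :
  ~ box M z -> M < `|z.1| \/ M < `|z.2|.
Proof.
move=> zM; have [|Mx] := ltP M `|z.1|; first by left.
have [|My] := ltP M `|z.2|; first by right.
by exfalso; apply: zM; split=> /=; rewrite in_itv/= -ler_norml.
Qed.

(** The complement of the box is open, so near each of its points the function is constantly 0. *)
Lemma C1_supp_box (R : realType) (T M t : R) (f fx fy ft : R * R * R -> R) :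
  C1 T f fx fy ft -> supp_box M (fun z => f (z, t)) ->
  supp_box M (fun z => fx (z, t)) /\ supp_box M (fun z => fy (z, t)).
Proof.
move=> [_ _ _ _ [dfx dfy _]] sf; split=> -[x y] xyM.
- apply: is_derive_near0 (dfx x y t) _.
  have [/= Mx|/= My] := notin_box xyM.
    by have := near_normr_gt Mx; apply: filterS => s Ms; apply: sf; exact: notin_boxl.
  by near=> s; apply: sf; exact: notin_boxr.
- apply: is_derive_near0 (dfy x y t) _.
  have [/= Mx|/= My] := notin_box xyM.
    by near=> s; apply: sf; exact: notin_boxl.
  by have := near_normr_gt My; apply: filterS => s Ms; apply: sf; exact: notin_boxr.
Unshelve. all: by end_near. Qed.

Lemma C1_supp_box_dt (R : realType) (T M a b : R) (f fx fy ft : R * R * R -> R) :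
  0 <= a -> b <= T -> C1 T f fx fy ft ->
  (forall t, a < t < b -> supp_box M (fun z => f (z, t))) ->
  forall t, a < t < b -> supp_box M (fun z => ft (z, t)).
Proof.
move=> a0 bT [_ _ _ _ [_ _ dft]] sf t tab z zM.
have tT : 0 < t < T by case/andP: tab => *; apply/andP; split; lra.
apply: is_derive_near0 (dft z t tT) _.
have : t \in `]a, b[ by rewrite in_itv.
move=> /near_in_itvoo; apply: filterS => s; rewrite in_itv/= => sab.
exact: sf.
Qed.

(* The flux terms are kept in the integrand, where the equations of motion
   cancel them against [qt], although their integrals vanish. *)
Lemma balance_law (R : realType) (T M a b : R)
    (q qx qy qt f fx fy ft g gx gy gt : R * R * R -> R) :
  0 <= a -> b <= T -> C1 T q qx qy qt -> C1 T f fx fy ft -> C1 T g gx gy gt ->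
  (forall t, a < t < b -> supp_box M (fun z => q (z, t))) ->
  (forall t, a < t < b -> supp_box M (fun z => f (z, t))) ->
  (forall t, a < t < b -> supp_box M (fun z => g (z, t))) ->
  forall t : R, a < t < b ->
  is_derive t 1 (fun s => \int[lebesgue2 R]_z q (z, s))
    (\int[lebesgue2 R]_z (qt (z, t) + fx (z, t) + gy (z, t))).
Proof.
move=> a0 bT Cq Cf Cg sq sf sg t tab.
have sqt := C1_supp_box_dt a0 bT Cq sq.
have [sfx _] := C1_supp_box Cf (sf t tab).
have [_ sgy] := C1_supp_box Cg (sg t tab).
have [cq _ _ cqt [_ _ dqt]] := Cq.
have [_ cfx _ _ [dfx _ _]] := Cf.
have [_ _ cgy _ [_ dgy _]] := Cg.
have ifx := integrable_supp_box (continuous_pair1 (y := t) cfx) sfx.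
have igy := integrable_supp_box (continuous_pair1 (y := t) cgy) sgy.
have iqt := integrable_supp_box (continuous_pair1 (y := t) cqt) (sqt t tab).
have -> : \int[lebesgue2 R]_z (qt (z, t) + fx (z, t) + gy (z, t)) =
    \int[lebesgue2 R]_z qt (z, t).
  rewrite RintegralD//; last first.
    by rewrite (_ : _ \o _ =
      (EFin \o (fun z => qt (z, t))) \+ (EFin \o (fun z => fx (z, t))))%E//;
      exact: integrableD.
  rewrite RintegralD// (@Rintegral_dx_eq0 _ M (fun z => f (z, t)))//.
  - rewrite (@Rintegral_dy_eq0 _ M (fun z => g (z, t)))// ?addr0//.
    + exact: continuous_pair1.
    + exact: sg.
  - exact: continuous_pair1.
  - exact: sf.
apply: (is_derive_Rintegral_supp cq cqt sq sqt) => // z s sab.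
by apply: dqt; case/andP: sab => *; apply/andP; split; lra.
Qed.

(** The product [f t * expR (- C * t)] is nonincreasing, whatever the sign of [C]. *)
Lemma gronwall_nonpos (R : realType) (a b C : R) (f f' : R -> R) :
  {within [set` `[a, b]%R], continuous f} ->
  (forall t : R, a < t < b -> is_derive t 1 f (f' t)) ->
  (forall t, a < t < b -> f' t <= C * f t) -> f a <= 0 ->
  forall t, a <= t <= b -> f t <= 0.
Proof.
move=> cf df f'C fa t /andP[at_ tb].
pose g s := f s * expR (- C * s).
have de (s : R) : is_derive s 1 (fun s => expR (- C * s)) (- C * expR (- C * s)).
  have dl : is_derive s 1 (fun s : R => - C * s) (- C).
    apply: is_derive_eq (is_derive_mul (is_derive_cst _ _ _) (is_derive_id _ _)) _.
    by rewrite mul0r add0r mulr1.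
  have := is_derive_chain (g := expR) (g' := expR) (fun y => is_derive_expR y) dl.
  by rewrite mulrC.
have dg (s : R) : a < s < b -> 
    is_derive s 1 g (f' s * expR (- C * s) + f s * (- C * expR (- C * s))).
  by move=> sab; exact: is_derive_mul (df s sab) (de s).
have : g t <= g a.
  apply: (@ler0_derive1_le_cc _ g a b); rewrite ?in_itv/= ?lexx ?at_ ?(le_trans at_)//.
  - by move=> s; rewrite in_itv/= => sab; have [] := dg s sab.
  - move=> s; rewrite in_itv/= => sab; rewrite derive1E.
    have := dg s sab => ?; rewrite derive_val.
    have := f'C s sab; have := expR_gt0 (- C * s); nra.
  - move=> s; apply: cvgM; first exact: cf.
    apply: continuous_subspaceT => {}s.
    by apply/differentiable_continuous/derivable1_diffP.
rewrite /g => gta; rewrite -(@pmulr_lle0 _ (expR (- C * t))) ?expR_gt0//.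
by rewrite (le_trans gta)// pmulr_lle0// expR_gt0.
Qed.

Lemma supp_boxD (R : realType) (M : R) (f g : R * R -> R) :
  supp_box M f -> supp_box M g -> supp_box M (fun z => f z + g z).
Proof. by move=> sf sg z zM; rewrite sf// sg// addr0. Qed.

Lemma supp_boxMl (R : realType) (M : R) (f g : R * R -> R) :
  supp_box M f -> supp_box M (fun z => f z * g z).
Proof. by move=> sf z zM; rewrite sf// mul0r. Qed.

Lemma supp_boxMr (R : realType) (M : R) (f g : R * R -> R) :
  supp_box M g -> supp_box M (fun z => f z * g z).
Proof. by move=> sg z zM; rewrite sg// mulr0. Qed.

(** The fluxes integrate to zero, so Gronwall keeps the integral of [q] nonpositive; as [q] is
    nonnegative and continuous, it vanishes everywhere. *)
Lemma zero_of_differential_inequality (R : realType) (T M a b C : R)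
    (q qx qy qt f fx fy ft g gx gy gt : R * R * R -> R) :
  0 <= a -> a <= b -> b <= T ->
  C1 T q qx qy qt -> C1 T f fx fy ft -> C1 T g gx gy gt ->
  (forall t, a <= t <= b -> supp_box M (fun z => q (z, t))) ->
  (forall t, a <= t <= b -> supp_box M (fun z => f (z, t))) ->
  (forall t, a <= t <= b -> supp_box M (fun z => g (z, t))) ->
  (forall z t, a <= t <= b -> 0 <= q (z, t)) ->
  (forall z t, a < t < b -> qt (z, t) + fx (z, t) + gy (z, t) <= C * q (z, t)) ->
  (forall z, q (z, a) = 0) ->
  forall z t, a <= t <= b -> q (z, t) = 0.
Proof.
move=> a0 ab bT Cq Cf Cg sq sf sg q0 qC qa z t tab.
have W s : a < s < b -> a <= s <= b by case/andP=> ? ?; rewrite !ltW.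
have sq' s (sab : a < s < b) := sq s (W s sab).
have sf' s (sab : a < s < b) := sf s (W s sab).
have sg' s (sab : a < s < b) := sg s (W s sab).
have [cq cqx cqy cqt _] := Cq; have [_ cfx _ _ _] := Cf; have [_ _ cgy _ _] := Cg.
have dI := balance_law a0 bT Cq Cf Cg sq' sf' sg'.
have cI := continuous_Rintegral_supp ab cq sq.
pose I s := \int[lebesgue2 R]_z q (z, s).
have It : I t <= 0.
  apply: (gronwall_nonpos (C := C) cI dI) tab; last first.
    by rewrite /Rintegral integral0_eq//= => w _; rewrite qa.
  move=> s sab; rewrite -RintegralZl//; last first.
    by apply: integrable_supp_box (sq' s sab); exact: continuous_pair1.
  have sS : supp_box M (fun z => qt (z, s) + fx (z, s) + gy (z, s)).
    apply: supp_boxD; first apply: supp_boxD.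
    - exact: (C1_supp_box_dt a0 bT Cq sq').
    - by have [] := C1_supp_box Cf (sf' s sab).
    - by have [] := C1_supp_box Cg (sg' s sab).
  apply: le_Rintegral => //; last by move=> w _; exact: qC.
  - apply: integrable_supp_box sS.
    by apply: continuous_add; [apply: continuous_add|]; exact: continuous_pair1.
  - apply: (integrable_supp_box (M := M)).
      by apply: continuous_mul; [exact: continuous_const|exact: continuous_pair1].
    by apply: supp_boxMr; exact: sq'.
apply: (Rintegral_eq0_supp _ (sq t tab)) => [|w|]; first exact: continuous_pair1.
- exact: q0.
- by apply/eqP; rewrite eq_le It/=; apply: Rintegral_ge0 => w _; exact: q0.
Qed.

(** * Finite speed of propagation *)

(** The products in the mass equation are expanded because only the derivatives of [h], [u] and [v]
    are carried as data. *)
Record flow (R : realType) (T : R)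
    (h hx hy ht u ux uy ut v vx vy vt : R * R * R -> R) : Prop := Flow {
  flow_h : C1 T h hx hy ht;
  flow_u : C1 T u ux uy ut;
  flow_v : C1 T v vx vy vt;
  flow_mass : forall (z : R * R) (t : R), 0 < t < T ->
    ht (z, t) = - (hx (z, t) * u (z, t) + h (z, t) * ux (z, t))
      - (hy (z, t) * v (z, t) + h (z, t) * vy (z, t));
  flow_momx : forall (z : R * R) (t : R), 0 < t < T ->
    ut (z, t) = v (z, t) - u (z, t) * ux (z, t) - v (z, t) * uy (z, t)
      - hx (z, t);
  flow_momy : forall (z : R * R) (t : R), 0 < t < T ->
    vt (z, t) = - u (z, t) - u (z, t) * vx (z, t) - v (z, t) * vy (z, t)
      - hy (z, t)
}.

Lemma cauchy_schwarz2 (R : realType) (x y u v a b : R) : 0 <= a -> 0 <= b ->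
  x ^+ 2 + y ^+ 2 <= a ^+ 2 -> u ^+ 2 + v ^+ 2 <= b ^+ 2 ->
  `|x * u + y * v| <= a * b.
Proof.
move=> a0 b0 xya uvb; rewrite -ler_sqr ?nnegrE ?mulr_ge0// real_normK ?num_real//.
have lagrange : (x * u + y * v) ^+ 2 =
    (x ^+ 2 + y ^+ 2) * (u ^+ 2 + v ^+ 2) - (x * v - y * u) ^+ 2 by ring.
rewrite lagrange exprMn.
have : (x ^+ 2 + y ^+ 2) * (u ^+ 2 + v ^+ 2) <= a ^+ 2 * b ^+ 2.
  by apply: ler_pM => //; rewrite addr_ge0 ?sqr_ge0.
by have := sqr_ge0 (x * v - y * u); lra.
Qed.

(* The lateral boundary of a cone expanding backwards at speed [s + d] is not
   crossed by energy: [s] is the sound speed and [d] bounds the velocity. *)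
Lemma lateral_flux_ge0 (R : realType) (s d rho x y u v eta : R) :
  0 <= s -> 0 <= d -> 0 <= rho -> x ^+ 2 + y ^+ 2 <= rho ^+ 2 ->
  u ^+ 2 + v ^+ 2 <= d ^+ 2 ->
  0 <= rho * (s + d) * (eta ^+ 2 + s ^+ 2 * (u ^+ 2 + v ^+ 2))
       + (x * u + y * v) * ((eta ^+ 2 + s ^+ 2 * (u ^+ 2 + v ^+ 2)) + 2 * s ^+ 2 * eta).
Proof.
move=> s0 d0 r0 xyr uvd; set e := eta ^+ 2 + _.
pose m := Num.sqrt (u ^+ 2 + v ^+ 2).
have m0 : 0 <= m := sqrtr_ge0 _.
have uv0 : 0 <= u ^+ 2 + v ^+ 2 by rewrite addr_ge0 ?sqr_ge0.
have m2 : m ^+ 2 = u ^+ 2 + v ^+ 2 by rewrite sqr_sqrtr.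
have md : m <= d by rewrite -ler_sqr ?nnegrE// m2.
have e0 : 0 <= e.
  by apply: addr_ge0; [exact: sqr_ge0|apply: mulr_ge0 => //; exact: sqr_ge0].
have K : `|x * u + y * v| <= rho * m by apply: cauchy_schwarz2; rewrite ?m2.
have me : m * (e + 2 * s ^+ 2 * `|eta|) <= (s + d) * e.
  have eE : e = (`|eta|) ^+ 2 + (s * m) ^+ 2.
    by rewrite real_normK ?num_real// exprMn m2.
  have := sqr_ge0 (`|eta| - s * m) => sq.
  (* The sound speed enters here: by the arithmetic-geometric inequality the work of the pressure is
     at most [s * e], while transport costs at most [d * e]. *)
  have h1 : 2 * (s * m) * `|eta| <= e by rewrite eE; nra.
  have h2 : s * (2 * (s * m) * `|eta|) <= s * e by rewrite ler_wpM2l.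
  have h3 : m * e <= d * e by rewrite ler_wpM2r.
  have -> : m * (e + 2 * s ^+ 2 * `|eta|) = m * e + s * (2 * (s * m) * `|eta|) by ring.
  by lra.
have : `|(x * u + y * v) * (e + 2 * s ^+ 2 * eta)| <= rho * ((s + d) * e).
  rewrite normrM; apply: (@le_trans _ _ (rho * m * (e + 2 * s ^+ 2 * `|eta|))).
    apply: ler_pM => //; rewrite (le_trans (ler_normD _ _))//.
    have a0 : 0 <= 2 * s ^+ 2 by rewrite mulr_ge0// sqr_ge0.
    by rewrite (ger0_norm e0) normrM (ger0_norm a0).
  by rewrite -mulrA ler_wpM2l.
by rewrite ler_norml => /andP[+ _]; lra.
Qed.

Lemma ler_pM_norm (R : realType) (C D e f : R) :
  - C <= D <= C -> - e <= f <= e -> D * f <= C * e.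
Proof. by move=> /andP[D1 D2] /andP[f1 f2]; nra. Qed.

Lemma C1_ext (R : realType) (T : R) (f fx fy ft fx' fy' ft' : R * R * R -> R) :
  C1 T f fx fy ft -> fx =1 fx' -> fy =1 fy' -> ft =1 ft' -> C1 T f fx' fy' ft'.
Proof. by move=> Cf /funext <- /funext <- /funext <-. Qed.

(* As long as [t <= t0 + l / c], positive exactly inside the shrinking disc of
   radius [l + c (t0 - t)]; then [sqpos \o cone] is a C^1 cutoff. *)
Definition cone (R : realType) (l c t0 a b : R) (p : R * R * R) : R :=
  (l + c * (t0 - p.2)) ^+ 2 - (p.1.1 - a) ^+ 2 - (p.1.2 - b) ^+ 2.

Lemma C1_cone (R : realType) (T l c t0 a b : R) :
  C1 T (cone l c t0 a b) (fun p => - (2 * (p.1.1 - a)))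
    (fun p => - (2 * (p.1.2 - b))) (fun p => - (2 * c * (l + c * (t0 - p.2)))).
Proof.
have Cx := C1_sub (C1_xcoord T) (C1_cst T a).
have Cy := C1_sub (C1_ycoord T) (C1_cst T b).
have Ct := C1_add (C1_cst T l)
  (C1_mul (C1_cst T c) (C1_sub (C1_cst T t0) (C1_tcoord T))).
apply: C1_ext (C1_sub (C1_sub (C1_mul Ct Ct) (C1_mul Cx Cx)) (C1_mul Cy Cy)) _ _ _;
  by move=> p /=; ring.
Qed.

Lemma cone_box (R : realType) (l c t0 a b rho t : R) (z : R * R) :
  `|l + c * (t0 - t)| <= rho -> 0 < cone l c t0 a b (z, t) ->
  box (rho + `|a| + `|b|) z.
Proof.
move=> r_rho; rewrite /cone/= => w0; set r := l + _ in r_rho w0.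
have rr : r ^+ 2 <= rho ^+ 2.
  by rewrite -(real_normK (num_real r)) lerXn2r ?nnegrE// (le_trans _ r_rho).
have rho0 : 0 <= rho by rewrite (le_trans _ r_rho).
have bound (x c0 : R) : (x - c0) ^+ 2 <= rho ^+ 2 -> `|x| <= rho + `|c0|.
  rewrite -(real_normK (num_real (x - c0))) ler_sqr ?nnegrE// => H.
  by rewrite -(subrK c0 x) (le_trans (ler_normD _ _))// lerD2r.
have [a0 b0] : 0 <= `|a| /\ 0 <= `|b| by [].
have Bx : `|z.1| <= rho + `|a|.
  by apply: bound; have := sqr_ge0 (z.2 - b); lra.
have By : `|z.2| <= rho + `|b|.
  by apply: bound; have := sqr_ge0 (z.1 - a); lra.
by split=> /=; rewrite in_itv/= -ler_norml; lra.
Qed.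

Definition at_rest (R : realType) (hbar : R) (h u v : R * R * R -> R)
    (p : R * R * R) : Prop := [/\ h p = hbar, u p = 0 & v p = 0].

Lemma near_cone_x (R : realType) (T l c t0 a b x y t : R) :
  0 < cone l c t0 a b (x, y, t) -> \forall s \near x, 0 < cone l c t0 a b (s, y, t).
Proof.
move=> w0; have [_ _ _ _ [dx0 _ _]] := C1_cone T l c t0 a b.
have cw : {for x, continuous (fun s => cone l c t0 a b (s, y, t))}.
  by apply/differentiable_continuous/derivable1_diffP; have [] := dx0 x y t.
exact: (cvgr_gt _ cw).
Qed.

Lemma near_cone_y (R : realType) (T l c t0 a b x y t : R) :
  0 < cone l c t0 a b (x, y, t) -> \forall s \near y, 0 < cone l c t0 a b (x, s, t).
Proof.
move=> w0; have [_ _ _ _ [_ dy0 _]] := C1_cone T l c t0 a b.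
have cw : {for y, continuous (fun s => cone l c t0 a b (x, s, t))}.
  by apply/differentiable_continuous/derivable1_diffP; have [] := dy0 x y t.
exact: (cvgr_gt _ cw).
Qed.

Lemma sqpos_eq0 (R : realType) (x : R) : x <= 0 -> sqpos x = 0.
Proof. by move=> x0; rewrite /sqpos max_l// expr0n. Qed.

Lemma sqpos_ge0 (R : realType) (x : R) : 0 <= sqpos x.
Proof. exact: sqr_ge0. Qed.

(** The density [(h - s ^ 2) ^ 2 + s ^ 2 * (u ^ 2 + v ^ 2)] is the energy of the system linearised
    at rest. Its weights are constant, so it is nonnegative whatever the sign of [h], which is
    settled only later and by means of the finite speed. The Coriolis force does no work, and the
    nonlinear terms leave the divergence of the velocity times a quantity bounded by the density.
    The cutoff adds the lateral flux with the favourable sign. *)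
Lemma cone_step (R : realType) (T s d l t0 a b t1 t2 : R)
    (h hx hy ht u ux uy ut v vx vy vt : R * R * R -> R) :
  flow T h hx hy ht u ux uy ut v vx vy vt ->
  0 <= s -> 0 <= d -> 0 < l -> 0 <= t1 -> t1 <= t2 -> t2 <= T -> t2 <= t0 ->
  (forall z t, t1 <= t <= t2 -> 0 < cone l (s + d) t0 a b (z, t) ->
    u (z, t) ^+ 2 + v (z, t) ^+ 2 <= d ^+ 2) ->
  (forall z, 0 < cone l (s + d) t0 a b (z, t1) -> at_rest (s ^+ 2) h u v (z, t1)) ->
  forall z t, t1 <= t <= t2 -> 0 < cone l (s + d) t0 a b (z, t) ->
    at_rest (s ^+ 2) h u v (z, t).
Proof.
move=> [Ch Cu Cv Em Eu Ev] s0 d0 l0 t10 t12 t2T t20 slow rest1.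
pose w := cone l (s + d) t0 a b.
pose M := (l + (s + d) * t0) + `|a| + `|b|.
have Cw := C1_cone T l (s + d) t0 a b; have Cphi := C1_sqpos Cw.
have radius t : t1 <= t <= t2 -> 0 <= l + (s + d) * (t0 - t) /\
    l + (s + d) * (t0 - t) <= l + (s + d) * t0.
  move=> /andP[tt1 tt2]; have sd : 0 <= s + d by lra.
  by have := mulr_ge0 sd (_ : 0 <= t0 - t); have := mulr_ge0 sd (_ : 0 <= t); nra.
have inbox t z : t1 <= t <= t2 -> 0 < w (z, t) -> box M z.
  by move=> tt; apply: cone_box; have [r0 ?] := radius t tt; rewrite ger0_norm.
have supp f t : t1 <= t <= t2 -> supp_box M (fun z => sqpos (w (z, t)) * f (z, t)).
  move=> tt z zM; rewrite sqpos_eq0 ?mul0r// leNgt; apply/negP => wz.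
  exact/zM/(inbox t).
have [[ch _ _ _ _] [cu cux cuy _ _] [cv cvx cvy _ _]] := And3 Ch Cu Cv.
have [C [C0 HC]] : exists C, 0 <= C /\ forall z t, t1 <= t <= t2 -> box M z ->
    `|ux (z, t) + vy (z, t)| <= C.
  have cK : compact (box M `*` [set` `[t1, t2]]).
    by apply: compact_setX; [exact: compact_box|exact: segment_compact].
  have [C [C0 HC]] := bounded_on_compact cK (continuous_add cux cvy).
  by exists C; split=> // z t tt zM; apply: HC; split=> //=; rewrite in_itv.
have W t : t1 < t < t2 -> t1 <= t <= t2 /\ 0 < t < T.
  by move=> /andP[? ?]; split; apply/andP; split; lra.
have lateral t (z : R * R) (eta : R) : t1 <= t <= t2 -> 0 < w (z, t) ->
    0 <= (l + (s + d) * (t0 - t)) * (s + d) *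
           (eta ^+ 2 + s ^+ 2 * (u (z, t) ^+ 2 + v (z, t) ^+ 2)) +
         ((z.1 - a) * u (z, t) + (z.2 - b) * v (z, t)) *
           ((eta ^+ 2 + s ^+ 2 * (u (z, t) ^+ 2 + v (z, t) ^+ 2)) + 2 * s ^+ 2 * eta).
  move=> tt wz; apply: lateral_flux_ge0 => //.
  - by have [] := radius t tt.
  - by move: wz; rewrite /w /cone/=; lra.
  - exact: slow.
(* This first energy controls only the height when [s = 0]. *)
have eta0 z t : t1 <= t <= t2 -> 0 < w (z, t) -> h (z, t) = s ^+ 2.
  have Ceta := C1_sub Ch (C1_cst T (s ^+ 2)).
  have Ce := C1_add (C1_mul Ceta Ceta)
    (C1_mul (C1_cst T (s ^+ 2)) (C1_add (C1_mul Cu Cu) (C1_mul Cv Cv))).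
  have Cke := C1_add Ce (C1_mul (C1_cst T (2 * s ^+ 2)) Ceta).
  have e0 p : 0 <= (h p - s ^+ 2) * (h p - s ^+ 2) + s ^+ 2 * (u p * u p + v p * v p).
    rewrite -!expr2; apply: addr_ge0; first exact: sqr_ge0.
    by apply: mulr_ge0; [exact: sqr_ge0|apply: addr_ge0; exact: sqr_ge0].
  move=> tt wz; have wz' : 0 < sqpos (w (z, t)).
    by rewrite /sqpos max_r ?exprn_gt0// ltW.
  have : sqpos (w (z, t)) * ((h (z, t) - s ^+ 2) * (h (z, t) - s ^+ 2) +
      s ^+ 2 * (u (z, t) * u (z, t) + v (z, t) * v (z, t))) = 0.
    have Z := zero_of_differential_inequality (C := C) t10 t12 t2T (C1_mul Cphi Ce)
      (C1_mul Cphi (C1_mul Cu Cke)) (C1_mul Cphi (C1_mul Cv Cke))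
      (supp _) (supp _) (supp _).
    apply: (Z _ _ _ z t tt) => {Z} [z' t' tt'|z' t' tt'|z'].
    - by rewrite mulr_ge0 ?sqpos_ge0//; exact: e0.
    - have [tc tT] := W t' tt'.
      rewrite -/w Em// Eu// Ev//= /sqpos.
      have [wp|wn] := ltP 0 (w (z', t')); last first.
        by rewrite expr0n/=; lra.
      have L := lateral t' z' (h (z', t') - s ^+ 2) tc wp.
      have := HC z' t' tc (inbox t' z' tc wp); rewrite ler_norml => /andP[D1 D2].
      move: wp L D1 D2; set W' := w _; set rho := l + _.
      move: (h _) (hx _) (hy _) (u _) (ux _) (uy _) (v _) (vx _) (vy _)
        => H Hx Hy U Ux Uy V Vx Vy.
      move: (z'.1 - a) (z'.2 - b) => X Y wp L D1 D2.
      set eta := H - s ^+ 2 in L *.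
      pose e := eta ^+ 2 + s ^+ 2 * (U ^+ 2 + V ^+ 2).
      (* The first term collects the derivatives of the cutoff [W' ^+ 2], namely [- 4 * W'] times
         the lateral flux; the second collects those of the density, with [Ux + Vy] the
         divergence. *)
      rewrite [leLHS](_ : _ =
        - (4 * W' * (rho * (s + d) * e + (X * U + Y * V) * (e + 2 * s ^+ 2 * eta)))
        + W' ^+ 2 * ((Ux + Vy) * (e - 2 * eta ^+ 2))); last first.
        by rewrite /e /eta; ring.
      have sUV : 0 <= s ^+ 2 * (U ^+ 2 + V ^+ 2).
        by apply: mulr_ge0; [exact: sqr_ge0|apply: addr_ge0; exact: sqr_ge0].
      have B : (Ux + Vy) * (e - 2 * eta ^+ 2) <= C * e.
        apply: ler_pM_norm; apply/andP; split=> //; have := sqr_ge0 eta; rewrite /e; lra.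
      have WB := ler_wpM2l (sqr_ge0 W') B.
      have WL := mulr_ge0 (ltW wp) L.
      rewrite -/e in WL.
      rewrite [leRHS](_ : _ = W' ^+ 2 * (C * e)); last by rewrite /e; ring.
      by lra.
    - have [wp|wn] := ltP 0 (w (z', t1)).
        have [-> -> ->] := rest1 z' wp.
        by rewrite subrr !mul0r !addr0 !mulr0 ?addr0 ?mulr0.
      by rewrite sqpos_eq0 ?mul0r.
  move=> /eqP; rewrite mulf_eq0 gt_eqF//= => /eqP e_eq0.
  have := e_eq0; have := sqr_ge0 (h (z, t) - s ^+ 2); rewrite expr2 => h1.
  have h2 : 0 <= s ^+ 2 * (u (z, t) * u (z, t) + v (z, t) * v (z, t)).
    by apply: mulr_ge0; [exact: sqr_ge0|apply: addr_ge0; exact: sqr_ge0].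
  move=> h3; have /eqP : (h (z, t) - s ^+ 2) * (h (z, t) - s ^+ 2) = 0 by lra.
  by rewrite mulf_eq0 orbb subr_eq0 => /eqP.
(* Inside the cone the height is now constant, so the pressure gradient drops
   out of the kinetic energy balance. *)
have Cm := C1_add (C1_mul Cu Cu) (C1_mul Cv Cv).
move=> z t tt wz; have wz' : 0 < sqpos (w (z, t)).
  by rewrite /sqpos max_r ?exprn_gt0// ltW.
suff : sqpos (w (z, t)) * (u (z, t) * u (z, t) + v (z, t) * v (z, t)) = 0.
  move=> /eqP; rewrite mulf_eq0 gt_eqF//= paddr_eq0 -?expr2 ?sqr_ge0//.
  rewrite !sqrf_eq0 => /andP[/eqP u0 /eqP v0]; split=> //; exact: eta0.
have Z := zero_of_differential_inequality (C := C) t10 t12 t2T (C1_mul Cphi Cm)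
  (C1_mul Cphi (C1_mul Cu Cm)) (C1_mul Cphi (C1_mul Cv Cm))
  (supp _) (supp _) (supp _).
apply: (Z _ _ _ z t tt) => {Z} [z' t' tt'|[x y] t' tt'|z'].
- by rewrite mulr_ge0 ?sqpos_ge0// -!expr2 addr_ge0 ?sqr_ge0.
- have [tc tT] := W t' tt'.
  rewrite -/w Eu// Ev//= /sqpos.
  have [wp|wn] := ltP 0 (w (x, y, t')); last by rewrite expr0n/=; lra.
  have [_ _ _ _ [dhx dhy _]] := C1_sub Ch (C1_cst T (s ^+ 2)).
  have hx0 : hx (x, y, t') = 0.
    rewrite -[LHS]subr0; apply: is_derive_near0 (dhx x y t') _.
    have := near_cone_x T wp; apply: filterS => x' wx'.
    by rewrite (eta0 (x', y) t')// subrr.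
  have hy0 : hy (x, y, t') = 0.
    rewrite -[LHS]subr0; apply: is_derive_near0 (dhy x y t') _.
    have := near_cone_y T wp; apply: filterS => y' wy'.
    by rewrite (eta0 (x, y') t')// subrr.
  have [rho0 _] := radius t' tc.
  have K : `|(x - a) * u (x, y, t') + (y - b) * v (x, y, t')| <=
      (l + (s + d) * (t0 - t')) * d.
    apply: cauchy_schwarz2 => //; last exact: slow.
    by move: wp; rewrite /w /cone/=; lra.
  have := HC (x, y) t' tc (inbox t' (x, y) tc wp); rewrite hx0 hy0 ler_norml => /andP[D1 D2].
  move: wp K D1 D2; set W' := w _; move: rho0; set rho := l + _ => rho0.
  move: (u _) (ux _) (uy _) (v _) (vx _) (vy _) => U Ux Uy V Vx Vy.
  move: (x - a) (y - b) => X Y wp; rewrite ler_norml => /andP[K _] D1 D2.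
  pose m := U ^+ 2 + V ^+ 2.
  have m0 : 0 <= m by rewrite addr_ge0 ?sqr_ge0.
  rewrite [leLHS](_ : _ = - (4 * W' * ((rho * (s + d) + (X * U + Y * V)) * m))
    + W' ^+ 2 * ((Ux + Vy) * m)); last by rewrite /m; ring.
  rewrite [leRHS](_ : _ = W' ^+ 2 * (C * m)); last by rewrite /m; ring.
  have WB := ler_wpM2l (sqr_ge0 W') (ler_wpM2r m0 D2).
  (* Without pressure only transport crosses the lateral boundary, at a speed of at most [d]. *)
  have L : 0 <= rho * (s + d) + (X * U + Y * V).
    by have := mulr_ge0 rho0 s0; lra.
  have WL := mulr_ge0 (ltW wp) (mulr_ge0 L m0).
  by lra.
- have [wp|wn] := ltP 0 (w (z', t1)).
    have [_ -> ->] := rest1 z' wp.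
    by rewrite !mul0r addr0 mulr0.
  by rewrite sqpos_eq0 ?mul0r.
Qed.

(** Needed to follow a fixed point of the plane back in time without leaving the cone. *)
Lemma cone_decreasing (R : realType) (l c t0 a b t1 t2 : R) (z : R * R) :
  0 < l -> 0 <= c -> t1 <= t2 -> t2 <= t0 ->
  cone l c t0 a b (z, t2) <= cone l c t0 a b (z, t1).
Proof.
move=> l0 c0 t12 t20; rewrite /cone/= !lerD2r.
have H : 0 <= c * (t0 - t2) by rewrite mulr_ge0// subr_ge0.
have H' : c * (t0 - t2) <= c * (t0 - t1) by rewrite ler_wpM2l// lerD2l lerN2.
by rewrite lerXn2r ?nnegrE//; lra.
Qed.

Lemma lipschitz_of_derive (R : realType) (f f' : R -> R) (L a b : R) : a <= b ->
  {within [set` `[a, b]%R], continuous f} ->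
  (forall t : R, a < t < b -> is_derive t 1 f (f' t)) ->
  (forall t, a < t < b -> `|f' t| <= L) -> `|f b - f a| <= L * (b - a).
Proof.
rewrite le_eqVlt => /orP[/eqP <-|ab] cf df bf; first by rewrite !subrr mulr0 normr0.
have df' (t : R) : t \in `]a, b[%R -> is_derive t 1 f (f' t).
  by rewrite in_itv/=; exact: df.
have [c cab ->] := MVT ab df' cf.
have ba : 0 <= b - a by rewrite subr_ge0 ltW.
by rewrite normrM (ger0_norm ba) ler_wpM2r//; apply: bf; rewrite in_itv in cab.
Qed.

Lemma C1_lipschitz_t (R : realType) (T L t1 t2 : R) (f fx fy ft : R * R * R -> R) z :
  C1 T f fx fy ft -> 0 <= t1 -> t1 <= t2 -> t2 <= T ->
  (forall t, t1 <= t <= t2 -> `|ft (z, t)| <= L) ->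
  `|f (z, t2) - f (z, t1)| <= L * (t2 - t1).
Proof.
move=> [cf _ _ _ [_ _ dft]] t10 t12 t2T bft.
apply: (@lipschitz_of_derive _ (fun t => f (z, t)) (fun t => ft (z, t))) => //.
- by apply: continuous_subspaceT; exact: continuous_pair2.
- by move=> t /andP[? ?]; apply: dft; apply/andP; split; lra.
- by move=> t /andP[? ?]; apply: bft; apply/andP; split; lra.
Qed.

(** The velocity bound assumed in [cone_step] follows from its conclusion with a delay: rest at one
    time keeps the velocity small shortly afterwards. The delay is positive because [d] is. *)
Lemma cone_at_rest (R : realType) (T s d l t0 a b : R)
    (h hx hy ht u ux uy ut v vx vy vt : R * R * R -> R) :
  flow T h hx hy ht u ux uy ut v vx vy vt ->
  0 <= s -> 0 < d -> 0 < l -> t0 <= T ->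
  (forall z, 0 < cone l (s + d) t0 a b (z, 0) -> at_rest (s ^+ 2) h u v (z, 0)) ->
  forall z t, 0 <= t <= t0 -> 0 < cone l (s + d) t0 a b (z, t) ->
    at_rest (s ^+ 2) h u v (z, t).
Proof.
move=> fl s0 d0 l0 t0T rest0.
have sd0 : 0 <= s + d by lra.
have [_ Cu Cv _ _ _] := fl; have [_ _ _ cut _] := Cu; have [_ _ _ cvt _] := Cv.
pose M := (l + (s + d) * t0) + `|a| + `|b|.
have cK : compact (box M `*` [set` `[0, t0]]).
  by apply: compact_setX; [exact: compact_box|exact: segment_compact].
have [Lu [Lu0 HLu]] := bounded_on_compact cK cut.
have [Lv [Lv0 HLv]] := bounded_on_compact cK cvt.
(* The [+ 1] keeps [L] positive even if both acceleration bounds are 0, so that [tau] is a positive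
   time. *)
pose L := Lu + Lv + 1; have L0 : 0 < L by rewrite /L; lra.
pose tau := d / (2 * L); have tau0 : 0 < tau by rewrite divr_gt0// mulr_gt0.
have Ltau : L * tau = d / 2 by rewrite /tau; field; rewrite gt_eqF.
(* A velocity starting from zero stays below [d / 2] during a time [tau], which
   is uniform on the compact cone; so [cone_step] can be iterated. *)
suff step n : forall z t, 0 <= t <= t0 -> t <= n%:R * tau ->
    0 < cone l (s + d) t0 a b (z, t) -> at_rest (s ^+ 2) h u v (z, t).
  move=> z t tt wz; apply: (step (Num.truncn (t / tau)).+1) => //.
  by rewrite -ler_pdivrMr// ltW// truncnS_gt.
elim: n => [z t /andP[t_ge0 _]|n IHn z t /andP[t_ge0 tt0] tn wz].
  rewrite mul0r => t_le0 wz; have t_eq0 : t = 0 by lra.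
  by rewrite t_eq0 in wz *; exact: rest0.
have [tn'|tn'] := leP t (n%:R * tau); first by apply: IHn => //; apply/andP.
have t10 : 0 <= n%:R * tau by rewrite mulr_ge0// ltW.
have [t1t t1t0] : n%:R * tau <= t /\ n%:R * tau <= t0 by lra.
apply: (cone_step fl s0 (ltW d0) l0 t10 t1t _ tt0) wz; last by rewrite t1t lexx.
- by lra.
- move=> z' t' /andP[t't1 t't] wz'.
  have t't0 : t' <= t0 by lra.
  have wz1 : 0 < cone l (s + d) t0 a b (z', n%:R * tau).
    by apply: lt_le_trans wz' _; exact: cone_decreasing.
  have [_ u0 v0] : at_rest (s ^+ 2) h u v (z', n%:R * tau).
    by apply: IHn => //; apply/andP.
  have zM r : n%:R * tau <= r <= t' -> (box M `*` [set` `[0, t0]%R]) (z', r).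
    move=> /andP[r1 r2]; have rt0 : r <= t0 by lra.
    split; last by rewrite /= in_itv/=; apply/andP; split; lra.
    have wr : 0 < cone l (s + d) t0 a b (z', r).
      by apply: lt_le_trans wz' _; exact: cone_decreasing.
    apply: cone_box wr; rewrite ger0_norm; first by rewrite lerD2l ler_wpM2l//; lra.
    by rewrite addr_ge0 ?mulr_ge0//; lra.
  have tau' : t' - n%:R * tau <= tau.
    by move: tn; rewrite -natr1 mulrDl mul1r; lra.
  have small (f : R) (Lf : R) : 0 <= Lf -> Lf <= L ->
      `|f| <= Lf * (t' - n%:R * tau) -> f ^+ 2 <= (d / 2) ^+ 2.
    move=> Lf0 LfL fL; rewrite -(real_normK (num_real f)).
    have fd : `|f| <= d / 2.
      rewrite (le_trans fL)// -Ltau; apply: ler_pM => //; lra.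
    by rewrite lerXn2r ?nnegrE//; lra.
  have := C1_lipschitz_t Cu t10 t't1 (le_trans t't0 t0T)
    (fun r rr => HLu _ (zM r rr)).
  rewrite u0 subr0 => /small -/(_ Lu0) U.
  have := C1_lipschitz_t Cv t10 t't1 (le_trans t't0 t0T)
    (fun r rr => HLv _ (zM r rr)).
  rewrite v0 subr0 => /small -/(_ Lv0) V.
  have {}U := U ltac:(rewrite /L; lra); have {}V := V ltac:(rewrite /L; lra).
  by have := sqr_ge0 d; nra.
- by move=> z' wz'; apply: IHn => //; apply/andP.
Qed.

Lemma finite_speed (R : realType) (T s r : R)
    (h hx hy ht u ux uy ut v vx vy vt : R * R * R -> R) :
  flow T h hx hy ht u ux uy ut v vx vy vt -> 0 <= s -> 0 < r ->
  (forall z, ~ disc r z -> at_rest (s ^+ 2) h u v (z, 0)) ->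
  forall z t, 0 <= t <= T -> ~ disc (r + s * t) z -> at_rest (s ^+ 2) h u v (z, t).
Proof.
move=> fl s0 r0 rest0 [a b] t0 /andP[t00 t0T] nz.
pose D := Num.sqrt (a ^+ 2 + b ^+ 2).
have D0 : 0 <= D := sqrtr_ge0 _.
have D2 : D ^+ 2 = a ^+ 2 + b ^+ 2 by rewrite sqr_sqrtr// addr_ge0 ?sqr_ge0.
have st0 : 0 <= s * t0 by rewrite mulr_ge0.
have Dr : r + s * t0 < D.
  rewrite ltNge; apply/negP => Dr; apply: nz; rewrite /disc/= -D2.
  by rewrite lerXn2r ?nnegrE//; lra.
pose g := D - r - s * t0; have g0 : 0 < g by rewrite /g; lra.
(* The gap [g] between the point and the disc of influence is split: [l] is the radius left at time
   [t0], which puts the point inside the cone, and [d] is the excess of speed over [s]. The [+ 1]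
   keeps [d] positive at [t0 = 0] and makes [d * t0 < g / 2] strict. *)
pose l := g / 2; pose d := g / (2 * (t0 + 1)).
have l0 : 0 < l by rewrite /l; lra.
have d0 : 0 < d by rewrite divr_gt0//; lra.
have dt0 : d * t0 < g / 2.
  have -> : g / 2 = d * t0 + d by rewrite /d; field; lra.
  by lra.
apply: (cone_at_rest (a := a) (b := b) (t0 := t0) fl s0 d0 l0 t0T); last first.
- rewrite /cone/= subrr mulr0 addr0 !subrr expr0n/= !subr0.
  by rewrite exprn_gt0.
- by rewrite t00 lexx.
move=> z wz; apply: rest0 => zr.
have rho0 : 0 <= l + (s + d) * t0 by rewrite addr_ge0 ?mulr_ge0//; lra.
have rhoD : l + (s + d) * t0 < D - r by rewrite /l mulrDl; move: dt0; rewrite /g; lra.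
move: wz; rewrite /cone/= subr0; set rho := l + _ in rho0 rhoD * => wz.
have CS : `|z.1 * a + z.2 * b| <= r * D.
  by apply: cauchy_schwarz2; rewrite ?D2// ltW.
pose m := Num.sqrt (z.1 ^+ 2 + z.2 ^+ 2).
have m0 : 0 <= m := sqrtr_ge0 _.
have m2 : m ^+ 2 = z.1 ^+ 2 + z.2 ^+ 2 by rewrite sqr_sqrtr// addr_ge0 ?sqr_ge0.
have mr : m <= r by rewrite -ler_sqr ?nnegrE ?m2// ltW.
(* This yields the triangle inequality in squared form: a point of norm [m <= r] is at distance at
   least [D - m] from [(a, b)], which exceeds the radius [rho] of the base. *)
have CSm : `|z.1 * a + z.2 * b| <= m * D.
  by apply: cauchy_schwarz2; rewrite ?D2 ?m2.
move: CSm; rewrite ler_norml => /andP[_ CSm].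
have : rho ^+ 2 < (D - m) ^+ 2.
  by rewrite ltrXn2r ?nnegrE//; lra.
rewrite sqrrB m2 D2; have := wz; rewrite !sqrrB.
by lra.
Qed.

(** * Nonnegativity of the height and conservation laws *)

Lemma disc_box (R : realType) (r M : R) (z : R * R) :
  0 <= r -> r <= M -> disc r z -> box M z.
Proof.
move=> r0 rM; rewrite /disc/= => zr.
have bound (x : R) : x ^+ 2 <= r ^+ 2 -> `|x| <= M.
  rewrite -(real_normK (num_real x)) ler_sqr ?nnegrE// => xr.
  exact: le_trans xr rM.
by split; rewrite /= in_itv/= -ler_norml; apply: bound;
  have := sqr_ge0 z.1; have := sqr_ge0 z.2; lra.
Qed.

Definition rest_outside (R : realType) (T M hbar : R) (h u v : R * R * R -> R) :=
  forall z t, 0 <= t <= T -> ~ box M z -> at_rest hbar h u v (z, t).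

(** The squared negative part g of the height satisfies [g_t + div (g U) = - g div U], with U the
    velocity, so it stays zero. Since [hbar >= 0], g vanishes outside the box, and a bound on the
    divergence over the box suffices. The sign allows [h] to be the weight in the Cauchy-Schwarz
    inequality. *)
Lemma height_ge0 (R : realType) (T M hbar : R)
    (h hx hy ht u ux uy ut v vx vy vt : R * R * R -> R) :
  flow T h hx hy ht u ux uy ut v vx vy vt -> 0 <= T -> 0 <= hbar ->
  rest_outside T M hbar h u v -> (forall z, 0 <= h (z, 0)) ->
  forall z t, 0 <= t <= T -> 0 <= h (z, t).
Proof.
move=> [Ch Cu Cv Em _ _] T0 hbar0 rest h0 z t tT.
have Cg := C1_sqpos (C1_opp Ch).
have [_ cux _ _ _] := Cu; have [_ _ cvy _ _] := Cv.
have cK : compact (box M `*` [set` `[0, T]]).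
  by apply: compact_setX; [exact: compact_box|exact: segment_compact].
have [C [C0 HC]] := bounded_on_compact cK (continuous_add cux cvy).
have sg t' : 0 <= t' <= T -> supp_box M (fun z => sqpos (- h (z, t'))).
  move=> t'T z' z'M; have [-> _ _] := rest z' t' t'T z'M.
  by rewrite sqpos_eq0// oppr_le0.
have sgM f t' : 0 <= t' <= T -> supp_box M (fun z => sqpos (- h (z, t')) * f (z, t')).
  by move=> t'T; apply: supp_boxMl; exact: sg.
have Z := zero_of_differential_inequality (C := C) (lexx 0) T0 (lexx T) Cg
  (C1_mul Cg Cu) (C1_mul Cg Cv) sg (sgM _) (sgM _).
have {Z} : sqpos (- h (z, t)) = 0.
  apply: (Z _ _ _ z t tT) => {Z} [z' t' tt'|z' t' tt'|z'].
  - exact: sqpos_ge0.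
  - have tc : 0 <= t' <= T by case/andP: tt' => *; apply/andP; split; lra.
    rewrite Em//= /sqpos; have [hp|hn] := leP 0 (- h (z', t')); last first.
      by rewrite expr0n/=; lra.
    have [zM|zM] := pselect (box M z'); last first.
      have [h1 u1 v1] := rest z' t' tc zM.
      have -> : h (z', t') = 0 by lra.
      by rewrite oppr0; lra.
    have : `|ux (z', t') + vy (z', t')| <= C.
      by apply: HC; split=> //=; rewrite in_itv.
    rewrite ler_norml => /andP[D _].
    have K := ler_wpM2l (sqr_ge0 (h (z', t'))) D.
    by move: K; move: (h _) (hx _) (hy _) (u _) (ux _) (v _) (vy _) => *; lra.
  - by rewrite sqpos_eq0// oppr_le0.
move=> g0; rewrite -oppr_le0 leNgt; apply/negP => hp.
by move/eqP: g0; rewrite /sqpos max_r ?ltW// sqrf_eq0 gt_eqF.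
Qed.

Lemma supp_of_rest (R : realType) (T M hbar : R) (h u v f : R * R * R -> R) :
  rest_outside T M hbar h u v ->
  (forall p, h p = hbar -> u p = 0 -> v p = 0 -> f p = 0) ->
  forall t, 0 <= t <= T -> supp_box M (fun z => f (z, t)).
Proof. by move=> rest f0 t tT z zM; have [? ? ?] := rest z t tT zM; exact: f0. Qed.

Lemma supp_of_rest_oo (R : realType) (T M hbar : R) (h u v f : R * R * R -> R) :
  rest_outside T M hbar h u v ->
  (forall p, h p = hbar -> u p = 0 -> v p = 0 -> f p = 0) ->
  forall t, 0 < t < T -> supp_box M (fun z => f (z, t)).
Proof.
by move=> rest f0 t /andP[? ?]; apply: (supp_of_rest rest f0); rewrite !ltW.
Qed.

(** * Evolution of the mass, the energy and the momenta *)

Definition mass_at (R : realType) (hbar : R) (h : R * R * R -> R) (t : R) : R :=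
  mass hbar (fun z => h (z, t)).

Definition energy_at (R : realType) (hbar : R) (h u v : R * R * R -> R) (t : R) : R :=
  energy hbar (fun z => h (z, t)) (fun z => u (z, t)) (fun z => v (z, t)).

Definition P1_at (R : realType) (h u v : R * R * R -> R) (t : R) : R :=
  P1 (fun z => h (z, t)) (fun z => u (z, t)) (fun z => v (z, t)).

Definition P2_at (R : realType) (h u v : R * R * R -> R) (t : R) : R :=
  P2 (fun z => h (z, t)) (fun z => u (z, t)) (fun z => v (z, t)).

Lemma is_derive_mass (R : realType) (T M hbar : R)
    (h hx hy ht u ux uy ut v vx vy vt : R * R * R -> R) (t : R) :
  flow T h hx hy ht u ux uy ut v vx vy vt -> rest_outside T M hbar h u v ->
  0 < t < T -> is_derive t 1 (mass_at hbar h) 0.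
Proof.
move=> [Ch Cu Cv Em Eu Ev] rest tT.
have B := balance_law (lexx 0) (lexx T) (C1_sub Ch (C1_cst T hbar)) (C1_mul Ch Cu)
  (C1_mul Ch Cv) (supp_of_rest_oo rest _) (supp_of_rest_oo rest _)
  (supp_of_rest_oo rest _) tT.
apply: is_derive_eq (B _ _ _) _ => {B} [p -> _ _|p _ -> _|p _ _ ->|].
- by rewrite subrr.
- by rewrite mulr0.
- by rewrite mulr0.
- rewrite /Rintegral integral0_eq// => z _ /=.
  by rewrite Em//; congr EFin; ring.
Qed.

(** The flux is the velocity times [h (u ^ 2 + v ^ 2) + 2 h ^ 2]: one [h ^ 2] is transported, the
    other is the work of the pressure. *)
Lemma is_derive_energy (R : realType) (T M hbar : R)
    (h hx hy ht u ux uy ut v vx vy vt : R * R * R -> R) (t : R) :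
  flow T h hx hy ht u ux uy ut v vx vy vt -> rest_outside T M hbar h u v ->
  0 < t < T -> is_derive t 1 (energy_at hbar h u v) 0.
Proof.
move=> [Ch Cu Cv Em Eu Ev] rest tT.
have Chm := C1_mul Ch (C1_add (C1_mul Cu Cu) (C1_mul Cv Cv)).
have Chh := C1_mul Ch Ch.
have CF := C1_add Chm (C1_mul (C1_cst T 2) Chh).
have B := balance_law (lexx 0) (lexx T)
  (C1_sub (C1_add Chm Chh) (C1_cst T (hbar ^+ 2))) (C1_mul Cu CF) (C1_mul Cv CF)
  (supp_of_rest_oo rest _) (supp_of_rest_oo rest _) (supp_of_rest_oo rest _) tT.
apply: is_derive_eq (B _ _ _) _ => {B} [p -> -> ->|p _ -> _|p _ _ ->|].
- by ring.
- by rewrite mul0r.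
- by rewrite mul0r.
- rewrite /Rintegral integral0_eq// => z _ /=.
  by rewrite Em// Eu// Ev//; congr EFin; ring.
Qed.

(** Virial identity: pairing the momentum equation with the position leaves the trace of the stress
    tensor. In dimension two the pressure [(h ^ 2 - hbar ^ 2) / 2] counts twice, so this trace is
    exactly the density of [energy]; the Coriolis force supplies [P2]. Normalising the pressure by
    [hbar] leaves its gradient unchanged and bounds its support. *)
Lemma is_derive_P1 (R : realType) (T M hbar : R)
    (h hx hy ht u ux uy ut v vx vy vt : R * R * R -> R) (t : R) :
  flow T h hx hy ht u ux uy ut v vx vy vt -> rest_outside T M hbar h u v ->
  0 < t < T ->
  is_derive t 1 (P1_at h u v) (energy_at hbar h u v t + P2_at h u v t).
Proof.
move=> [Ch Cu Cv Em Eu Ev] rest tT.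
have Cx := C1_xcoord T; have Cy := C1_ycoord T.
have CK := C1_mul (C1_cst T (2^-1)) (C1_sub (C1_mul Ch Ch) (C1_cst T (hbar ^+ 2))).
have Cuv := C1_mul Ch (C1_mul Cu Cv).
have B := balance_law (lexx 0) (lexx T)
  (C1_add (C1_mul (C1_mul Ch Cu) Cx) (C1_mul (C1_mul Ch Cv) Cy))
  (C1_add (C1_mul Cx (C1_add (C1_mul Ch (C1_mul Cu Cu)) CK)) (C1_mul Cy Cuv))
  (C1_add (C1_mul Cx Cuv) (C1_mul Cy (C1_add (C1_mul Ch (C1_mul Cv Cv)) CK)))
  (supp_of_rest_oo rest _) (supp_of_rest_oo rest _) (supp_of_rest_oo rest _) tT.
apply: is_derive_eq (B _ _ _) _ => {B} [p _ -> ->|p -> -> ->|p -> -> ->|].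
- by ring.
- by ring.
- by ring.
have [[ch _ _ _ _] [cu _ _ _ _] [cv _ _ _ _]] := And3 Ch Cu Cv.
rewrite /energy_at /energy /P2_at /P2 -RintegralD//.
- apply: eq_Rintegral => -[x y] _ /=.
  by rewrite Em// Eu// Ev//; field.
- apply: (integrable_supp_box (M := M)).
    apply: (@continuous_pair1 _ _ _
      (fun p => h p * (u p ^+ 2 + v p ^+ 2) + h p ^+ 2 - hbar ^+ 2)).
    apply: continuous_sub; last exact: continuous_const.
    apply: continuous_add; last exact: continuous_sqr.
    by apply: continuous_mul => //; apply: continuous_add; exact: continuous_sqr.
  by apply: (supp_of_rest_oo (f :=
    (fun p => h p * (u p ^+ 2 + v p ^+ 2) + h p ^+ 2 - hbar ^+ 2)) rest _ tT) => p -> -> ->; ring.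
- apply: (integrable_supp_box (M := M)).
    apply: (@continuous_pair1 _ _ _ (fun p => h p * v p * p.1.1 - h p * u p * p.1.2)).
    apply: continuous_sub; apply: continuous_mul; try exact: continuous_mul.
      exact: continuous_xcoord.
    exact: continuous_ycoord.
  by apply: (supp_of_rest_oo (f :=
    (fun p => h p * v p * p.1.1 - h p * u p * p.1.2)) rest _ tT) => p _ -> ->; ring.
Qed.

(** The stress tensor is symmetric, so it exerts no net torque and only the Coriolis force
    remains. *)
Lemma is_derive_P2 (R : realType) (T M hbar : R)
    (h hx hy ht u ux uy ut v vx vy vt : R * R * R -> R) (t : R) :
  flow T h hx hy ht u ux uy ut v vx vy vt -> rest_outside T M hbar h u v ->
  0 < t < T -> is_derive t 1 (P2_at h u v) (- P1_at h u v t).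
Proof.
move=> [Ch Cu Cv Em Eu Ev] rest tT.
have Cx := C1_xcoord T; have Cy := C1_ycoord T.
have CK := C1_mul (C1_cst T (2^-1)) (C1_sub (C1_mul Ch Ch) (C1_cst T (hbar ^+ 2))).
have Cuv := C1_mul Ch (C1_mul Cu Cv).
have B := balance_law (lexx 0) (lexx T)
  (C1_sub (C1_mul (C1_mul Ch Cv) Cx) (C1_mul (C1_mul Ch Cu) Cy))
  (C1_sub (C1_mul Cx Cuv) (C1_mul Cy (C1_add (C1_mul Ch (C1_mul Cu Cu)) CK)))
  (C1_sub (C1_mul Cx (C1_add (C1_mul Ch (C1_mul Cv Cv)) CK)) (C1_mul Cy Cuv))
  (supp_of_rest_oo rest _) (supp_of_rest_oo rest _) (supp_of_rest_oo rest _) tT.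
apply: is_derive_eq (B _ _ _) _ => {B} [p _ -> ->|p -> -> ->|p -> -> ->|].
- by ring.
- by ring.
- by ring.
have [[ch _ _ _ _] [cu _ _ _ _] [cv _ _ _ _]] := And3 Ch Cu Cv.
rewrite /P1_at /P1 -[RHS]mulN1r -RintegralZl//.
  apply: eq_Rintegral => -[x y] _ /=.
  by rewrite Em// Eu// Ev//; field.
apply: (integrable_supp_box (M := M)).
  apply: (@continuous_pair1 _ _ _ (fun p => h p * u p * p.1.1 + h p * v p * p.1.2)).
  apply: continuous_add; apply: continuous_mul; try exact: continuous_mul.
    exact: continuous_xcoord.
  exact: continuous_ycoord.
by apply: (supp_of_rest_oo (f :=
    (fun p => h p * u p * p.1.1 + h p * v p * p.1.2)) rest _ tT) => p _ -> ->; ring.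
Qed.

(** * Rotation of the momenta and the bound on the radial momentum *)

Lemma constant_of_derive0 (R : realType) (T : R) (f : R -> R) :
  {within [set` `[0, T]%R], continuous f} ->
  (forall t : R, 0 < t < T -> is_derive t 1 f 0) ->
  forall t, 0 <= t <= T -> f t = f 0.
Proof.
move=> cf df t /andP[t0 tT]; apply/eqP.
have cft : {within [set` `[0, t]%R], continuous f}.
  apply: continuous_subspaceW cf => x /=; rewrite !in_itv/= => /andP[-> xt].
  exact: le_trans tT.
have dft (s : R) : 0 < s < t -> is_derive s 1 f 0.
  by move=> /andP[s0 st]; apply: df; rewrite s0 (lt_le_trans st).
have L s : 0 < s < t -> `|0 : R| <= 0 by rewrite normr0.
have := lipschitz_of_derive t0 cft dft L.
by rewrite mul0r normr_le0 subr_eq0.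
Qed.

Lemma rotation_vanishing (R : realType) (T : R) (p w : R -> R) : pi <= T ->
  {within [set` `[0, T]%R], continuous p} -> {within [set` `[0, T]%R], continuous w} ->
  (forall t : R, 0 < t < T -> is_derive t 1 p (w t)) ->
  (forall t : R, 0 < t < T -> is_derive t 1 w (- p t)) ->
  exists t : R, [/\ 0 <= t <= pi, w t = 0 & p t ^+ 2 = p 0 ^+ 2 + w 0 ^+ 2].
Proof.
move=> piT cp cw dp dw.
have csin : {within [set` `[0, T]%R], continuous (@sin R)}.
  by apply: continuous_subspaceT; exact: continuous_sin.
have ccos : {within [set` `[0, T]%R], continuous (@cos R)}.
  by apply: continuous_subspaceT; exact: continuous_cos.
have pi0 := pi_gt0 R.
have norm_cst t : 0 <= t <= T -> p t * p t + w t * w t = p 0 * p 0 + w 0 * w 0.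
  apply: (@constant_of_derive0 _ T (fun t => p t * p t + w t * w t)).
    by move=> s; apply: cvgD; apply: cvgM; by [exact: cp|exact: cw].
  move=> s sT; apply: is_derive_eq (is_deriveD (is_derive_mul (dp s sT) (dp s sT))
    (is_derive_mul (dw s sT) (dw s sT))) _.
  by ring.
(* This is the component of [(p, w)] along an axis turning with it. At time [pi] it gives
   [w pi = - w 0], so the intermediate value theorem finds a zero of [w] within half a period. *)
have angle_cst t : 0 <= t <= T -> p t * sin t + w t * cos t = p 0 * sin 0 + w 0 * cos 0.
  apply: (@constant_of_derive0 _ T (fun t => p t * sin t + w t * cos t)).
    move=> s; apply: cvgD; apply: cvgM;
      by [exact: cp|exact: cw|exact: csin|exact: ccos].
  move=> s sT; apply: is_derive_eq (is_deriveD
    (is_derive_mul (dp s sT) (is_derive_sin s))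
    (is_derive_mul (dw s sT) (is_derive_cos s))) _.
  by ring.
have wpi : w pi = - w 0.
  have := angle_cst pi; rewrite (ltW pi0) piT => /(_ isT).
  by rewrite sinpi cospi sin0 cos0; lra.
have cw' : {within [set` `[0, pi]%R], continuous w}.
  apply: continuous_subspaceW cw => x /=; rewrite !in_itv/= => /andP[-> xt].
  exact: le_trans piT.
have [|t] := @IVT _ w 0 pi 0 (ltW pi0) cw'.
  rewrite wpi ge_min le_max; have [w0|w0] := leP 0 (w 0).
    by rewrite oppr_le0 w0 orbT.
  by rewrite (ltW w0) oppr_ge0 (ltW w0) orbT.
rewrite in_itv/= => tpi wt0; exists t; split=> //.
have /norm_cst : 0 <= t <= T by case/andP: tpi => t0 tpi; rewrite t0 (le_trans tpi).
by rewrite wt0 mul0r addr0 -!expr2.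
Qed.

(** * Upper bounds for the mass and the radial momentum *)

Lemma lebesgue2_setT_gt0 (R : realType) : (0 < lebesgue2 R setT)%E.
Proof.
rewrite lt0e measure_ge0 andbT; apply/eqP => T0.
have ae0 : \forall z \ae lebesgue2 R, False by exists setT; split.
by have [] := ae_open_exists (z := (0, 0)) openT I ae0.
Qed.

(** The set where [f] exceeds its essential supremum is null, and open by continuity, hence
    empty. *)
Lemma Linfty_norm_continuous (R : realType) (f : R * R -> R) (C : R) :
  continuous f -> (forall z, 0 <= f z <= C) ->
  exists N : R, Linfty_norm f = N%:E /\ forall z, f z <= N.
Proof.
move=> cf fC; set n := Linfty_norm f.
have nE : n = ess_sup (lebesgue2 R) (abse \o (EFin \o f)).
  by rewrite /n /Linfty_norm unlock lebesgue2_setT_gt0.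
have n0 : (0 <= n)%E by exact: Lnorm_ge0.
have nC : (n <= C%:E)%E.
  rewrite nE; apply/ess_supP; apply: aeW => z /=.
  by have /andP[f0 ?] := fC z; rewrite lee_fin ger0_norm.
have nfin : n \is a fin_num by rewrite ge0_fin_numE// (le_lt_trans nC)// ltry.
exists (fine n); rewrite fineK//; split=> // z; rewrite leNgt; apply/negP => fz.
have oU : open [set w | fine n < f w].
  move/continuousP: cf => /(_ _ (@interval_open _ (BRight (fine n)) +oo%O isT isT)).
  rewrite (_ : _ @^-1` _ = [set w | fine n < f w])//.
  by apply/seteqP; split=> w /=; rewrite in_itv/= andbT.
have := ess_sup_ge (lebesgue2 R) (abse \o (EFin \o f)); rewrite -nE => aen.
have [w /= fw] := ae_open_exists oU fz aen.
have /andP[f0 _] := fC w; rewrite ger0_norm// -(fineK nfin) lee_fin.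
by rewrite leNgt fw.
Qed.

Lemma Rintegral_indic_disc (R : realType) (r : R) : 0 < r ->
  (lebesgue2 R).-integrable setT (EFin \o (\1_(disc r) : R * R -> R)) /\
  \int[lebesgue2 R]_z (\1_(disc r) z) <= pi * r ^+ 2.
Proof.
move=> r0; have mD := @measurable_disc R r; have dle := lebesgue2_disc r0.
have doo : (lebesgue2 R (disc r) < +oo)%E by rewrite (le_lt_trans dle)// ltry.
split.
  have := integrable_cst_indic 1 mD doo.
  by apply: eq_integrable => // z _ /=; rewrite mul1r.
rewrite /Rintegral integral_indic// setIT -lee_fin fineK//.
by rewrite ge0_fin_numE.
Qed.

(** Applied to the initial height, this trades the maximum, which is not conserved, for the mass,
    which is. *)
Lemma mass_le (R : realType) (r hbar N : R) (H : R * R -> R) :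
  0 < r -> continuous H -> (forall z, ~ disc r z -> H z = hbar) ->
  hbar <= N -> (forall z, H z <= N) ->
  mass hbar H <= (N - hbar) * (pi * r ^+ 2).
Proof.
move=> r0 cH Hout hN HN; have [iD leD] := Rintegral_indic_disc r0.
apply: (@le_trans _ _ ((N - hbar) * \int[lebesgue2 R]_z (\1_(disc r) z))); last first.
  by rewrite ler_wpM2l// subr_ge0.
rewrite -RintegralZl//; apply: le_Rintegral => //.
- apply: (integrable_supp_box (M := r)).
    by apply: continuous_sub => //; exact: continuous_const.
  move=> z zr; rewrite Hout ?subrr// => zD; apply: zr.
  exact: disc_box (ltW r0) (lexx r) zD.
- have := integrableZl (measurableT) (N - hbar) iD.
  by apply: eq_integrable => // z _ /=; rewrite EFinM.
- move=> z _; rewrite indicE; have [zr|/negP zr] := boolP (z \in _).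
    by rewrite mulr1 lerB.
  by rewrite mulr0 Hout ?subrr// => ?; apply: zr; rewrite inE.
Qed.

(** In the application [H] is the height at a later time and [N] the maximum of the initial height;
    [N] acts only through the mass. *)
Lemma momentum_lt_energy (R : realType) (rho hbar N : R) (H U V : R * R -> R) :
  0 < rho -> 0 <= hbar -> continuous H -> continuous U -> continuous V ->
  (forall z, 0 <= H z) ->
  (forall z, ~ disc rho z -> [/\ H z = hbar, U z = 0 & V z = 0]) ->
  0 < mass hbar H -> mass hbar H <= (N - hbar) * (pi * rho ^+ 2) ->
  P1 H U V ^+ 2 < pi * rho ^+ 4 * energy hbar H U V * N.
Proof.
move=> rho0 hbar0 cH cU cV H0 Hout m0 mN.
have out z : ~ box rho z -> [/\ H z = hbar, U z = 0 & V z = 0].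
  move=> zr; apply: Hout => zD; apply: zr.
  exact: disc_box (ltW rho0) (lexx rho) zD.
have [iD leD] := Rintegral_indic_disc rho0.
set m := mass hbar H in m0 mN *; set E := energy hbar H U V; set p := P1 H U V.
pose K := \int[lebesgue2 R]_z (H z * (U z ^+ 2 + V z ^+ 2)).
pose Q := \int[lebesgue2 R]_z ((H z - hbar) ^+ 2).
have cK : continuous (fun z => H z * (U z ^+ 2 + V z ^+ 2)).
  by apply: continuous_mul => //; apply: continuous_add; exact: continuous_sqr.
have ceta : continuous (fun z => H z - hbar).
  by apply: continuous_sub => //; exact: continuous_const.
have sK : supp_box rho (fun z => H z * (U z ^+ 2 + V z ^+ 2)).
  by move=> z /out[_ -> ->]; ring.
have seta : supp_box rho (fun z => H z - hbar).
  by move=> z /out[-> _ _]; ring.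
have sQ : supp_box rho (fun z => (H z - hbar) ^+ 2).
  by move=> z /seta ->; ring.
have iK := integrable_supp_box cK sK.
have ieta := integrable_supp_box ceta seta.
have iQ := integrable_supp_box (continuous_sqr ceta) sQ.
have Q0 : 0 <= Q by apply: Rintegral_ge0 => z _; exact: sqr_ge0.
have Qgt0 : 0 < Q.
  rewrite lt_neqAle Q0 andbT eq_sym; apply/eqP.
  move=> /(Rintegral_eq0_supp (continuous_sqr ceta) sQ) eta0.
  have : m = 0.
    rewrite /m /mass /Rintegral integral0_eq// => z _ /=.
    by have := eta0 (fun z => sqr_ge0 _) z => /eqP; rewrite sqrf_eq0 => /eqP ->.
  by move=> mE; rewrite mE ltxx in m0.
have intD f g : (lebesgue2 R).-integrable setT (EFin \o (f : R * R -> R)) ->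
    (lebesgue2 R).-integrable setT (EFin \o (g : R * R -> R)) ->
    (lebesgue2 R).-integrable setT (EFin \o (fun z => f z + g z)).
  by move=> fi gi; have := integrableD measurableT fi gi; apply: eq_integrable.
have intZ c f : (lebesgue2 R).-integrable setT (EFin \o (f : R * R -> R)) ->
    (lebesgue2 R).-integrable setT (EFin \o (fun z => c * f z)).
  by move=> fi; have := integrableZl measurableT c fi; apply: eq_integrable.
(* Expanding [H ^ 2 - hbar ^ 2] around [hbar] makes the potential part visibly positive, since
   [Q > 0] and [m > 0]. This gives the strictness needed against a non-strict assumption on the
   data. *)
have EE : E = K + (Q + 2 * hbar * m).
  rewrite /m /mass -RintegralZl// -RintegralD//; last exact: intZ.
  rewrite -RintegralD//; last by apply: intD => //; exact: intZ.
  by apply: eq_Rintegral => z _; ring.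
have KE : K < E.
  by rewrite EE; have := mulr_ge0 hbar0 (ltW m0); lra.
have K0 : 0 <= K.
  by apply: Rintegral_ge0 => z _; rewrite mulr_ge0// addr_ge0 ?sqr_ge0.
pose D := \int[lebesgue2 R]_z (\1_(disc rho) z : R).
have pi0 := pi_gt0 R.
have [rho2 prho2] : 0 < rho ^+ 2 /\ 0 < pi * rho ^+ 2.
  by split; rewrite ?mulr_gt0 ?exprn_gt0.
have Nh : 0 < N - hbar by rewrite -(pmulr_lgt0 _ prho2) (lt_le_trans m0).
have mass_disc : m + hbar * D <= pi * rho ^+ 2 * N.
  by have := ler_wpM2l hbar0 leD; rewrite -/D; lra.
(* Cauchy-Schwarz in quadratic form: expand [H * |x (U, V) - z| ^ 2 >= 0] and use [|z| <= rho] on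
   the disc. Outside the disc both integrands vanish. *)
have quad (x : R) : 2 * x * p <= x ^+ 2 * K + rho ^+ 2 * (m + hbar * D).
  have cp : continuous (fun z => H z * U z * z.1 + H z * V z * z.2).
    apply: continuous_add; apply: continuous_mul; try exact: continuous_mul.
      by move=> z; exact: cvg_fst.
    by move=> z; exact: cvg_snd.
  have sp : supp_box rho (fun z => H z * U z * z.1 + H z * V z * z.2).
    by move=> z /out[_ -> ->]; ring.
  have ip := integrable_supp_box cp sp.
  rewrite /p /P1 -RintegralZl// /K -RintegralZl// /m /mass /D -(RintegralZl hbar)//.
  rewrite -RintegralD//; last exact: intZ.
  have iS := intD _ _ ieta (intZ hbar _ iD).
  rewrite -(RintegralZl (rho ^+ 2))// -RintegralD//; [|exact: intZ|exact: intZ].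
  apply: le_Rintegral => //; first exact: intZ.
    by apply: intD; exact: intZ.
  move=> z _; rewrite indicE; have [/set_mem zr|/negP zr] := boolP (z \in disc rho).
    have h1 : 0 <= H z * ((x * U z - z.1) ^+ 2 + (x * V z - z.2) ^+ 2).
      by rewrite mulr_ge0// addr_ge0 ?sqr_ge0.
    have h2 := ler_wpM2l (H0 z) zr.
    rewrite mulr1 (_ : H z - hbar + hbar = H z); last by ring.
    by move: h1 h2; move: (H z) (U z) (V z) => *; lra.
  have [-> -> ->] : [/\ H z = hbar, U z = 0 & V z = 0].
    by apply: Hout => zD; apply: zr; rewrite inE.
  by rewrite mulr0; lra.
have E0 : 0 < E by lra.
have rhoN : 0 < rho ^+ 2 * (pi * rho ^+ 2 * N).
  by rewrite !mulr_gt0//; lra.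
rewrite (_ : pi * rho ^+ 4 * E * N = E * (rho ^+ 2 * (pi * rho ^+ 2 * N))); last by ring.
have [->|p0] := eqVneq p 0; first by rewrite expr0n/= mulr_gt0.
have p2 : 0 < p ^+ 2 by rewrite exprn_even_gt0.
have B := ler_wpM2l (ltW rho2) mass_disc.
(* The optimal choice would be [p / K], but [K] may vanish; with [p / E] the strict inequality
   [K < E] closes the estimate. *)
have := quad (p / E) => q.
have {}q := ler_wpM2l (sqr_ge0 E) (le_trans q (lerD (lexx _) B)).
have e1 : E ^+ 2 * (2 * (p / E) * p) = 2 * p ^+ 2 * E by field; rewrite gt_eqF.
have e2 : E ^+ 2 * ((p / E) ^+ 2 * K + rho ^+ 2 * (pi * rho ^+ 2 * N)) =
    p ^+ 2 * K + E * (E * (rho ^+ 2 * (pi * rho ^+ 2 * N))).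
  by field; rewrite gt_eqF.
rewrite e1 e2 in q.
have pK : p ^+ 2 * K < p ^+ 2 * E by rewrite ltr_pM2l.
by rewrite -(ltr_pM2l E0); lra.
Qed.

(** * From classical solutions to globally continuous flows *)

Lemma continuous_within_comp (T U V : topologicalType) (A : set U)
    (f : U -> V) (k : T -> U) :
  {within A, continuous f} -> continuous k -> (forall x, A (k x)) ->
  continuous (fun x => f (k x)).
Proof.
move=> /subspace_continuousP cf ck Ak x B nB.
have H : nbhs (k x) [set y | A y -> B (f y)] by exact: cf (k x) (Ak x) B nB.
have {}H : nbhs x [set y | A (k y) -> B (f (k y))] by exact: ck x _ H.
by apply: filterS H => y /= Hy; apply: Hy; exact: Ak.
Qed.

Definition clamp_time (R : realType) (T : R) (p : R * R * R) : R * R * R :=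
  (p.1, clamp 0 T p.2).

Lemma slab_clamp_time (R : realType) (T T' : R) (p : R * R * R) :
  0 <= T -> T < T' -> slab T' (clamp_time T p).
Proof.
move=> T0 TT'; rewrite /slab/=; have /andP[-> tT] := clamp_itv p.2 T0.
exact: le_lt_trans TT'.
Qed.

(** The directional derivative in space-time and the derivative of the slice are limits of the same
    quotient, so existence and value transfer together. *)
Lemma quotient_x (R : realType) (f : R * R * R -> R) (x y t : R) :
  (fun k : R => k^-1 *: (f (k *: e_x R + (x, y, t)) - f (x, y, t))) =
  (fun k : R => k^-1 *: (f (k *: 1 + x, y, t) - f (x, y, t))).
Proof.
apply/funext => k; congr (_ *: (f _ - _)).
by congr (_, _, _); rewrite /= scaler0 add0r.
Qed.

Lemma quotient_y (R : realType) (f : R * R * R -> R) (x y t : R) :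
  (fun k : R => k^-1 *: (f (k *: e_y R + (x, y, t)) - f (x, y, t))) =
  (fun k : R => k^-1 *: (f (x, k *: 1 + y, t) - f (x, y, t))).
Proof.
apply/funext => k; congr (_ *: (f _ - _)).
by congr (_, _, _); rewrite /= scaler0 add0r.
Qed.

Lemma is_derive_dx (R : realType) (f : R * R * R -> R) (x y t : R) :
  derivable f (x, y, t) (e_x R) ->
  is_derive x 1 (fun s => f (s, y, t)) (dx f (x, y, t)).
Proof.
rewrite /derivable quotient_x => df; split=> //.
by rewrite /dx /derive quotient_x.
Qed.

Lemma is_derive_dy (R : realType) (f : R * R * R -> R) (x y t : R) :
  derivable f (x, y, t) (e_y R) ->
  is_derive y 1 (fun s => f (x, s, t)) (dy f (x, y, t)).
Proof.
rewrite /derivable quotient_y => df; split=> //.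
by rewrite /dy /derive quotient_y.
Qed.

Lemma dx_of_is_derive (R : realType) (f : R * R * R -> R) (x y t d : R) :
  is_derive x 1 (fun s => f (s, y, t)) d -> dx f (x, y, t) = d.
Proof. by move=> [_ <-]; rewrite /dx /derive quotient_x. Qed.

Lemma dy_of_is_derive (R : realType) (f : R * R * R -> R) (x y t d : R) :
  is_derive y 1 (fun s => f (x, s, t)) d -> dy f (x, y, t) = d.
Proof. by move=> [_ <-]; rewrite /dy /derive quotient_y. Qed.

(** At positive times every small increment satisfies [0 <= t + s], so [dt] is an ordinary two-sided
    derivative there. *)
Lemma dt_filterE (R : realType) (t : R) : 0 < t -> dt_filter t = 0^'.
Proof.
move=> t0; have near_ge : \forall s \near (0 : R)^', 0 <= t + s.
  near=> s; have : `|s| <= t by near: s; exact: dnbhs0_le.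
  by rewrite ler_norml => /andP[]; lra.
rewrite /dt_filter; apply/seteqP; split=> P; rewrite /within/= => HP.
  by apply: filterS2 near_ge HP => s ? ; apply.
by apply: filterS HP.
Unshelve. all: by end_near. Qed.

Lemma is_derive_dt (R : realType) (f : R * R * R -> R) (z : R * R) (t : R) :
  0 < t -> dt_derivable f (z, t) ->
  is_derive t 1 (fun s => f (z, s)) (dt f (z, t)).
Proof.
move=> t0; rewrite /dt_derivable /dt -[(z, t).2]/t (dt_filterE t0).
have -> : dt_quotient f (z, t) =
    (fun k : R => k^-1 *: (f (z, k *: 1 + t) - f (z, t))).
  by apply/funext => k; rewrite /dt_quotient/= /GRing.scale/= mulr1 [k + t]addrC.
by move=> df; split.
Qed.

Lemma C1_of_slab (R : realType) (T T' : R) (f : R * R * R -> R) :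
  0 <= T -> T < T' -> C1_slab T' f ->
  C1 T (fun p => f (clamp_time T p)) (fun p => dx f (clamp_time T p))
    (fun p => dy f (clamp_time T p)) (fun p => dt f (clamp_time T p)).
Proof.
move=> T0 TT' [cf df [cdx cdy cdt]].
have ck : continuous (@clamp_time R T) by exact: continuous_clamp2.
have Sk p : slab T' (clamp_time T p) by exact: slab_clamp_time.
split.
- exact: (continuous_within_comp cf ck Sk).
- exact: (continuous_within_comp cdx ck Sk).
- exact: (continuous_within_comp cdy ck Sk).
- exact: (continuous_within_comp cdt ck Sk).
split=> [x y t|x y t|z t /andP[t0 tT]].
- have [dxf _ _] := df _ (Sk (x, y, t)).
  exact: (@is_derive_dx _ f x y (clamp 0 T t) dxf).
- have [_ dyf _] := df _ (Sk (x, y, t)).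
  exact: (@is_derive_dy _ f x y (clamp 0 T t) dyf).
rewrite /clamp_time/= clamp_id ?(ltW t0) ?(ltW tT)//.
have tS : slab T' (z, t) by rewrite /slab/= (ltW t0) (lt_trans tT TT').
have [_ _ dft] := df _ tS.
have dftz := is_derive_dt t0 dft.
apply: near_eq_is_derive dftz.
have : t \in `]0, T[ by rewrite in_itv/= t0.
move=> /near_in_itvoo; apply: filterS => s; rewrite in_itv/= => /andP[s0 sT].
by rewrite clamp_id ?ltW.
Qed.

Lemma flow_of_solution (R : realType) (T T' : R) (h0 u0 v0 : R * R -> R)
    (h u v : R * R * R -> R) :
  0 <= T -> T < T' -> classical_solution T' h0 u0 v0 h u v ->
  let k := @clamp_time R T in
  flow T (fun p => h (k p)) (fun p => dx h (k p)) (fun p => dy h (k p)) (fun p => dt h (k p))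
    (fun p => u (k p)) (fun p => dx u (k p)) (fun p => dy u (k p)) (fun p => dt u (k p))
    (fun p => v (k p)) (fun p => dx v (k p)) (fun p => dy v (k p)) (fun p => dt v (k p)).
Proof.
move=> T0 TT' [[Ch Cu Cv] sw _] /=.
have kE z t : 0 < t < T -> clamp_time T (z, t) = (z, t) /\ slab T' (z, t).
  move=> /andP[t0 tT]; split; last by rewrite /slab/= (ltW t0) (lt_trans tT TT').
  by rewrite /clamp_time/= clamp_id ?(ltW t0) ?(ltW tT).
split.
- exact: (C1_of_slab T0 TT' Ch).
- exact: (C1_of_slab T0 TT' Cu).
- exact: (C1_of_slab T0 TT' Cv).
- move=> [x y] t tT; have [-> sl] := kE (x, y) t tT; have [+ _ _] := sw _ sl.
  have [_ dh _] := Ch; have [_ du _] := Cu; have [_ dv _] := Cv.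
  have [dhx dhy _] := dh _ sl; have [dux _ _] := du _ sl; have [_ dvy _] := dv _ sl.
  rewrite (dx_of_is_derive (is_derive_mul (is_derive_dx dhx) (is_derive_dx dux))).
  rewrite (dy_of_is_derive (is_derive_mul (is_derive_dy dhy) (is_derive_dy dvy))).
  by lra.
- move=> z t tT; have [-> sl] := kE z t tT; have [_ + _] := sw _ sl.
  by lra.
- move=> z t tT; have [-> sl] := kE z t tT; have [_ _] := sw _ sl.
  by lra.
Qed.

Lemma supported_in_eq0 (R : realType) (f : R * R -> R) (A : set (R * R)) z :
  supported_in f A -> ~ A z -> f z = 0.
Proof.
move=> sf nA; apply/eqP; apply: contrapT => /negP fz; apply/nA/sf.
exact: subset_closure.
Qed.

Theorem theorem1p1 (R : realType) (h0 u0 v0 : R * R -> R) (hbar r : R)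
    (h0_ge0 : forall z, 0 <= h0 z)
    (hbar_ge0 : 0 <= hbar) (r_gt0 : 0 < r)
    (supp_h0 : supported_in (fun z => h0 z - hbar) (disc r))
    (supp_u0 : supported_in u0 (disc r))
    (supp_v0 : supported_in v0 (disc r))
    (mass_gt0 : 0 < mass hbar h0)
    (large_data :
      ((pi * (r + 2 * pi * Num.sqrt hbar) ^+ 4 * energy hbar h0 u0 v0)%:E
         * Linfty_norm h0
       <= (P1 h0 u0 v0 ^+ 2
             + (energy hbar h0 u0 v0 + P2 h0 u0 v0) ^+ 2)%:E)%E) :
  ~ (exists h u v : R * R * R -> R,
       classical_solution (2 * pi) h0 u0 v0 h u v).
Proof.
move=> [h' [u' [v' sol]]].
have pi0 := pi_gt0 R.
(* Any [T] with [pi <= T < 2 * pi] works: half a period of the rotation must fit in [0, T], and this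
   closed interval must lie in the half-open slab. *)
pose T : R := 3 / 2 * pi.
have [T0 piT T2pi] : [/\ 0 <= T, pi <= T & T < 2 * pi] by rewrite /T; split; lra.
have := flow_of_solution T0 T2pi sol => /=.
set h := fun p => h' _; set u := fun p => u' _; set v := fun p => v' _ => fl.
have clamp0 z : clamp_time T (z, 0) = (z, 0).
  by rewrite /clamp_time/= clamp_id// lexx.
have [_ _ init] := sol.
have h0E : (fun z => h (z, 0)) = h0.
  by apply/funext => z; rewrite /h clamp0; have [] := init z.
have u0E : (fun z => u (z, 0)) = u0.
  by apply/funext => z; rewrite /u clamp0; have [] := init z.
have v0E : (fun z => v (z, 0)) = v0.
  by apply/funext => z; rewrite /v clamp0; have [] := init z.
set s := Num.sqrt hbar in large_data.
have s0 : 0 <= s := sqrtr_ge0 _.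
have s2 : s ^+ 2 = hbar by rewrite sqr_sqrtr.
pose rho := r + 2 * pi * s.
have r_rho : r <= rho by rewrite lerDl !mulr_ge0// ltW.
have rho0 : 0 < rho by lra.
have h0_out z : ~ disc r z -> h0 z = hbar.
  by move=> /(supported_in_eq0 supp_h0)/eqP; rewrite subr_eq0 => /eqP.
have rest0 z : ~ disc r z -> at_rest (s ^+ 2) h u v (z, 0).
  move=> zr; rewrite s2; split.
  - by rewrite -(h0_out z zr) -h0E.
  - by rewrite -[LHS]/((fun z => u (z, 0)) z) u0E (supported_in_eq0 supp_u0 zr).
  - by rewrite -[LHS]/((fun z => v (z, 0)) z) v0E (supported_in_eq0 supp_v0 zr).
have rest_disc z t : 0 <= t <= T -> ~ disc rho z -> at_rest hbar h u v (z, t).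
  move=> tT zrho; rewrite -s2; apply: (finite_speed fl s0 r_gt0 rest0 tT).
  move: tT => /andP[t0 tT]; apply: contra_not zrho; rewrite /disc/= => /le_trans; apply.
  (* Since [T < 2 * pi], sound travels at most [2 * pi * s] by time [T], so the disc of radius [rho]
     encloses the perturbation throughout. *)
  have st : s * t <= s * (2 * pi) by rewrite ler_wpM2l//; lra.
  have st0 : 0 <= s * t by rewrite mulr_ge0.
  by rewrite lerXn2r ?nnegrE /rho; lra.
have rest : rest_outside T rho hbar h u v.
  move=> z t tT zrho; apply: rest_disc => // zD.
  exact/zrho/(disc_box (ltW rho0) (lexx rho)).
have hpos z t : 0 <= t <= T -> 0 <= h (z, t).
  apply: (height_ge0 fl T0 hbar_ge0 rest) => w.
  by rewrite -[h (w, 0)]/((fun z => h (z, 0)) w) h0E.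
have [Ch Cu Cv _ _ _] := fl.
have [[ch _ _ _ _] [cu _ _ _ _] [cv _ _ _ _]] := And3 Ch Cu Cv.
have cm : {within [set` `[0, T]%R], continuous (mass_at hbar h)}.
  pose F p := h p - hbar.
  apply: (continuous_Rintegral_supp (M := rho) (F := F) T0).
    by apply: continuous_sub => //; exact: continuous_const.
  by apply: (supp_of_rest (f := F) rest) => p hp _ _; rewrite /F hp subrr.
have cE : {within [set` `[0, T]%R], continuous (energy_at hbar h u v)}.
  pose F p := h p * (u p ^+ 2 + v p ^+ 2) + h p ^+ 2 - hbar ^+ 2.
  apply: (continuous_Rintegral_supp (M := rho) (F := F) T0).
    apply: continuous_sub; last exact: continuous_const.
    apply: continuous_add; last exact: continuous_sqr.
    by apply: continuous_mul => //; apply: continuous_add; exact: continuous_sqr.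
  apply: (supp_of_rest (f := F) rest) => p hp up vp; rewrite /F hp up vp; ring.
have cP1 : {within [set` `[0, T]%R], continuous (P1_at h u v)}.
  pose F p := h p * u p * p.1.1 + h p * v p * p.1.2.
  apply: (continuous_Rintegral_supp (M := rho) (F := F) T0).
    apply: continuous_add; apply: continuous_mul; try exact: continuous_mul.
      exact: continuous_xcoord.
    exact: continuous_ycoord.
  apply: (supp_of_rest (f := F) rest) => p _ up vp; rewrite /F up vp; ring.
have cP2 : {within [set` `[0, T]%R], continuous (P2_at h u v)}.
  pose F p := h p * v p * p.1.1 - h p * u p * p.1.2.
  apply: (continuous_Rintegral_supp (M := rho) (F := F) T0).
    apply: continuous_sub; apply: continuous_mul; try exact: continuous_mul.
      exact: continuous_xcoord.
    exact: continuous_ycoord.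
  apply: (supp_of_rest (f := F) rest) => p _ up vp; rewrite /F up vp; ring.
have m_cst := constant_of_derive0 cm (fun t => is_derive_mass fl rest (t := t)).
have E_cst := constant_of_derive0 cE (fun t => is_derive_energy fl rest (t := t)).
have m0E : mass_at hbar h 0 = mass hbar h0 by rewrite /mass_at h0E.
have E0E : energy_at hbar h u v 0 = energy hbar h0 u0 v0.
  by rewrite /energy_at h0E u0E v0E.
set E := energy hbar h0 u0 v0 in large_data E0E.
have cw : {within [set` `[0, T]%R], continuous (fun t => E + P2_at h u v t)}.
  by move=> t; apply: cvgD; [exact: cvg_cst|exact: cP2].
have [t [tpi wt0 pt2]] : exists t : R, [/\ 0 <= t <= pi, E + P2_at h u v t = 0 &
    P1_at h u v t ^+ 2 = P1_at h u v 0 ^+ 2 + (E + P2_at h u v 0) ^+ 2].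
  apply: (rotation_vanishing piT cP1 cw) => t tT.
    apply: is_derive_eq (is_derive_P1 fl rest tT) _.
    by rewrite E_cst ?E0E//; case/andP: tT => ? ?; rewrite !ltW.
  apply: is_derive_eq (is_deriveD (is_derive_cst E t 1) (is_derive_P2 fl rest tT)) _.
  by rewrite add0r.
have tT : 0 <= t <= T by case/andP: tpi => -> /le_trans; apply.
have ch0 : continuous h0 by rewrite -h0E; exact: continuous_pair1.
have [C [C0 HC]] := bounded_on_compact (@compact_box R r) ch0.
have [N [NE HN]] : exists N : R, Linfty_norm h0 = N%:E /\ forall z, h0 z <= N.
  apply: (Linfty_norm_continuous (C := C + hbar) ch0) => z; rewrite h0_ge0/=.
  have [zr|zr] := pselect (disc r z); last by rewrite h0_out// lerDr.
  have := HC z (disc_box (ltW r_gt0) (lexx r) zr).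
  by rewrite ger0_norm// => /le_trans; apply; rewrite lerDl.
(* This sign of [N - hbar] makes the bound on the mass monotone in the radius, which lets [r] be
   replaced by [rho]. *)
have hN : hbar <= N.
  rewrite -(h0_out (r + 1, 0)); first exact: HN.
  by rewrite /disc/= expr0n/= addr0 ler_sqr ?nnegrE; lra.
have m_le := mass_le r_gt0 ch0 h0_out hN HN.
have : P1_at h u v t ^+ 2 < pi * rho ^+ 4 * energy_at hbar h u v t * N.
  apply: momentum_lt_energy => //.
  - exact: continuous_pair1.
  - exact: continuous_pair1.
  - exact: continuous_pair1.
  - by move=> z; exact: hpos.
  - by move=> z /(rest_disc _ _ tT).
  - by rewrite -[mass _ _]/(mass_at hbar h t) m_cst// m0E.
  - rewrite -[mass _ _]/(mass_at hbar h t) m_cst// m0E (le_trans m_le)//.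
    rewrite ler_wpM2l ?subr_ge0// ler_wpM2l ?(ltW pi0)//.
    by rewrite lerXn2r ?nnegrE ?(ltW r_gt0) ?(ltW rho0).
rewrite E_cst// E0E pt2 /P1_at /P2_at h0E u0E v0E.
by move: large_data; rewrite NE -EFinM lee_fin -/rho leNgt => /negP.
Qed.
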